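(* Let $N\ge 3$, let $\lambda_1,\dots,\lambda_N>0$ with $\sum_{i=1}^N\lambda_i=1$, let $S,Y\subseteq\mathbb R^n$ be compact, and let $\rho\in\mathcal P_{\mathrm{ac}}(S)$. Then there exists a constant $C>0$, depending only on $N$ and $\operatorname{diam}(S\cup Y)$, such that for any $\mu_2,\dots,\mu_N\in\mathcal P(Y)$ and any $\tilde\mu_2,\dots,\tilde\mu_N\in\mathcal P(Y)$, $$\sum_{i=2}^N\lambda_i\|T_i-\tilde T_i\|_{L^2(\rho)}\le C\left(\Big(\sum_{i=2}^N\lambda_iW_1(\mu_i,\tilde\mu_i)\Big)^{1/2}+\|B-\tilde B\|_{L^2(\rho)}\right),$$ where $(T_2,\dots,T_N)$ and $(\tilde T_2,\dots,\tilde T_N)$ are the multi-marginal optimal transport maps associated with $(\rho,\mu_2,\dots,\mu_N)$ and $(\rho,\tilde\mu_2,\dots,\tilde\mu_N)$ respectively, and $B=\lambda_1\mathrm{Id}+\sum_{i=2}^N\lambda_iT_i$, $\tilde B=\lambda_1\mathrm{Id}+\sum_{i=2}^N\lambda_i\tilde T_i$.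
   Context: $\mathcal P(E)$ is the set of Borel probability measures on $E$; $\mathcal P_{\mathrm{ac}}(S)$ is the set of probability measures on $S$ absolutely continuous with respect to the Lebesgue measure $\mathcal L^n$. $W_1$ is the 1-Wasserstein distance for the Euclidean distance. The barycentric quadratic cost is $c(x_1,\dots,x_N)=\inf_{y\in\mathbb R^n}\sum_{i=1}^N\frac{\lambda_i}{2}|x_i-y|^2=\frac12\sum_{1\le i<j\le N}\lambda_i\lambda_j|x_i-x_j|^2$. Given $\rho\in\mathcal P_{\mathrm{ac}}(S)$ and $\mu_2,\dots,\mu_N\in\mathcal P(Y)$, the multi-marginal optimal transport maps associated with $(\rho,\mu_2,\dots,\mu_N)$ are the ($\rho$-a.e. unique, by a theorem of Gangbo and Święch) minimizers $(T_2,\dots,T_N)$ of $\int_S c(x_1,T_2(x_1),\dots,T_N(x_1))\,d\rho(x_1)$ among maps $T_i:S\to Y$ with $(T_i)_\#\rho=\mu_i$, $i=2,\dots,N$; moreover $(\mathrm{Id},T_2,\dots,T_N)_\#\rho$ is the unique minimizer of $\int c\,d\pi$ over probability measures $\pi$ on $S\times Y^{N-1}$ with marginals $\rho,\mu_2,\dots,\mu_N$. *)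

(* Defs.v *)
From HB Require Import structures.
From mathcomp Require Import all_boot all_order all_algebra.
From mathcomp Require Import all_classical all_reals all_analysis.

Set Implicit Arguments.
Unset Strict Implicit.
Unset Printing Implicit Defensive.

Import Order.TTheory GRing.Theory Num.Theory.
Import numFieldNormedType.Exports.

Local Open Scope classical_set_scope.
Local Open Scope ring_scope.

(* R^n with its Borel sigma-algebra; the carrier is convertible to 'rV[R]_n. *)
Notation borel_rV R n := (g_sigma_algebraType (@open 'rV[R]_n)).

(* The library norm on 'rV[R]_n is the sup norm (it induces the same topology,
   hence the same compact and Borel sets). *)
Definition enorm (R : realType) (n : nat) (x : 'rV[R]_n) : R :=
  Num.sqrt (\sum_(j < n) x ord0 j ^+ 2).

Definition ediam (R : realType) (n : nat) (A : set 'rV[R]_n) : R :=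
  sup [set enorm (p.1 - p.2) | p in A `*` A].

(* n-dimensional Lebesgue measure as an iterated integral (Cavalieri):
   L^0 is the Dirac mass and L^(n+1)(A) = \int L^n (A_t) dt, where
   A_t = {v | (t, v) \in A}. On Borel sets this is the n-fold product of the
   one-dimensional Lebesgue measure. *)
Fixpoint lebesgue_rV (R : realType) (n : nat) : set 'rV[R]_n -> \bar R :=
  match n with
  | 0 => fun A : set 'rV[R]_0 => (\1_A 0)%:E
  | m.+1 => fun A : set 'rV[R]_(1 + m) =>
      (\int[@lebesgue_measure R]_t
         lebesgue_rV [set v : 'rV[R]_m | A (row_mx (t%:M : 'rV[R]_1) v)])%E
  end.

(* Elements of P(S), S a Borel subset of R^n, are the Borel probability
   measures on R^n that give mass 1 to S. *)
Definition prob_on (R : realType) (n : nat) (S : set 'rV[R]_n)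
    (mu : probability (borel_rV R n) R) : Prop :=
  mu S = 1%E.

Definition prob_ac_on (R : realType) (n : nat) (S : set 'rV[R]_n)
    (rho : probability (borel_rV R n) R) : Prop :=
  prob_on S rho /\ rho `<< (@lebesgue_rV R n : set (borel_rV R n) -> \bar R).

Definition coupling (R : realType) (n : nat)
    (mu nu : probability (borel_rV R n) R)
    (pi : probability (borel_rV R n * borel_rV R n)%type R) : Prop :=
  forall A : set (borel_rV R n), measurable A ->
    pi (A `*` setT) = mu A /\ pi (setT `*` A) = nu A.

Definition wasserstein1 (R : realType) (n : nat)
    (mu nu : probability (borel_rV R n) R) : \bar R :=
  ereal_inf [set (\int[pi]_z (enorm (z.1 - z.2 : 'rV[R]_n))%:E)%E
            | pi in coupling mu nu].

Definition bary_cost (R : realType) (n N : nat) (lam : 'I_N -> R)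
    (x : 'I_N -> 'rV[R]_n) : R :=
  inf [set \sum_(i < N) lam i / 2 * enorm (x i - y) ^+ 2
      | y in [set: 'rV[R]_n]].

(* Indices run over 0, ..., N-1, so index 0 is the marginal rho. Families of
   maps and of target measures are indexed by all of 'I_N, and their value at
   index 0 is never used. *)

(* (x, T_2(x), ..., T_N(x)) *)
Definition with_id (R : realType) (n N : nat)
    (T : 'I_N -> 'rV[R]_n -> 'rV[R]_n) (x : 'rV[R]_n) : 'I_N -> 'rV[R]_n :=
  fun i => if (0 < i)%N then T i x else x.

Definition bary_map (R : realType) (n N : nat) (lam : 'I_N -> R)
    (T : 'I_N -> 'rV[R]_n -> 'rV[R]_n) (x : 'rV[R]_n) : 'rV[R]_n :=
  \sum_(i < N) lam i *: with_id T x i.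

(* T : S -> Y is a total function of which only the restriction to S matters. *)
Definition transport_map (R : realType) (n : nat) (S Y : set 'rV[R]_n)
    (rho mu : probability (borel_rV R n) R)
    (T : borel_rV R n -> borel_rV R n) : Prop :=
  [/\ measurable_fun (S : set (borel_rV R n)) T,
      (forall x, S x -> Y (T x)) &
      (forall A : set (borel_rV R n), measurable A ->
         rho (S `&` T @^-1` A) = mu A)].

Definition mm_transport_maps (R : realType) (n N : nat) (S Y : set 'rV[R]_n)
    (rho : probability (borel_rV R n) R)
    (mu : 'I_N -> probability (borel_rV R n) R)
    (T : 'I_N -> 'rV[R]_n -> 'rV[R]_n) : Prop :=
  forall i : 'I_N, (0 < i)%N -> transport_map S Y rho (mu i) (T i).

Definition mm_monge_cost (R : realType) (n N : nat) (lam : 'I_N -> R)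
    (S : set 'rV[R]_n) (rho : probability (borel_rV R n) R)
    (T : 'I_N -> 'rV[R]_n -> 'rV[R]_n) : \bar R :=
  (\int[rho]_(x in S) (bary_cost lam (with_id T x))%:E)%E.

Definition mm_optimal_maps (R : realType) (n N : nat) (lam : 'I_N -> R)
    (S Y : set 'rV[R]_n) (rho : probability (borel_rV R n) R)
    (mu : 'I_N -> probability (borel_rV R n) R)
    (T : 'I_N -> 'rV[R]_n -> 'rV[R]_n) : Prop :=
  mm_transport_maps S Y rho mu T /\
  forall U : 'I_N -> 'rV[R]_n -> 'rV[R]_n,
    mm_transport_maps S Y rho mu U ->
    (mm_monge_cost lam S rho T <= mm_monge_cost lam S rho U)%E.

(* L^2(rho) norm of a vector-valued function on S. *)
Definition L2norm (R : realType) (n : nat) (S : set 'rV[R]_n)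
    (rho : probability (borel_rV R n) R) (f : 'rV[R]_n -> 'rV[R]_n) : \bar R :=
  'N[rho]_2%:E[EFin \o ((fun x : borel_rV R n => enorm (f x)) \_ S)].

(* Main.v *)
Require Import Defs.
From HB Require Import structures.
From mathcomp Require Import all_boot all_order all_algebra.
From mathcomp Require Import all_classical all_reals all_analysis.
From mathcomp Require Import measurable_realfun lra ring.

Set Implicit Arguments.
Unset Strict Implicit.
Unset Printing Implicit Defensive.

Import Order.TTheory GRing.Theory Num.Theory.
Import numFieldNormedType.Exports.

Local Open Scope classical_set_scope.
Local Open Scope ring_scope.

(** Write [c = bary_cost lam] and [b] for the barycenter of a configuration [x].
    Since [c x = \sum_i lam i / 2 * |x i|^2 - |b|^2 / 2], only [|b|^2] sees how
    the marginals are coupled. Fix [i > 0] and, at every point of [S], exchange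
    the i-th components of the two optimal families: let [U] be [T] with [T' i]
    in place of [T i], and [U'] be [T'] with [T i] in place of [T' i]. In the sum
    of the two costs the terms [|x i|^2] cancel while the two barycenters move by
    opposite multiples of [T i - T' i], and completing a square gives, pointwise
    ([bary_cost_swap]),
      [c U + c U' + lam i ^ 2 * |T i - T' i|^2 / 2 <= c T + c T' + |B - B'|^2 / 2].

    The maps [U] have the marginals of [T], except for the i-th one, which is
    [mu' i]. Replacing the i-th component [T' i] of [U] by a map [V] of law
    [mu i] yields a competitor of [T], and raises the cost by at most
    [lam i * D * \int |V - T' i|], with [D] the diameter. As [V] can be chosen
    with [\int |V - T' i|] arbitrarily close to [W_1 (mu i) (mu' i)]
    ([transport_rearrangement]), optimality of [T] bounds [\int c T] by
    [\int c U + lam i * D * W_1] ([optimal_cost_le_update]), and likewise for [T']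
    and [U']. Integrating the pointwise inequality then leaves
      [lam i ^ 2 * |T i - T' i|_2 ^ 2 <= |B - B'|_2 ^ 2 + 4 * lam i * D * W_1]
    ([swap_stability]); take square roots and add over [i].

    It remains to find [V]. Given a coupling of [mu' i] and [mu i], cut the
    space into countably many small cells and look, for each cell, at the
    conditional law of the second marginal given that the first one falls into
    the cell; [V] must push the restriction of [rho] to the preimage of the cell
    under [T' i] onto this law ([discrete_transport], [rearrangement]). Such
    maps exist because [rho], being absolutely continuous, does not charge the
    hyperplanes [x_0 = r]: the first coordinate is a real random variable
    without atoms, its distribution function makes it uniform, a quantile
    function turns the uniform law into any law on the line
    ([quantile_transport]), and [R^n] is Borel isomorphic to a subset of [0, 1]
    ([encode], [decode]). *)

(** * Transporting an atomless random variable *)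

Section uniformization.
Context d (T : measurableType d) (R : realType) (P : probability T R).
Variable f : {RV P >-> R}.
Hypothesis f0 : forall r, P (f @^-1` [set r]) = 0%E.
Local Open Scope ereal_scope.

Lemma atomless_cdf_lt (s : R) : P (f @^-1` `]-oo, s[) = cdf f s.
Proof.
rewrite /cdf /distribution /pushforward.
have -> : f @^-1` `]-oo, s] = f @^-1` `]-oo, s[ `|` f @^-1` [set s].
  by rewrite -preimage_setU setUitv1.
rewrite measureU0//; [exact: measurable_funPTI|exact: f0].
Qed.

(** The left continuity of the distribution function of an atomless variable,
    in the form in which suprema of sublevel sets use it. *)
Lemma atomless_cdf_le (s : R) (c : \bar R) :
  (forall r, (r < s)%R -> cdf f r <= c) -> cdf f s <= c.
Proof.
move=> H; rewrite -atomless_cdf_lt.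
pose F n := f @^-1` `]-oo, (s - n.+1%:R^-1)%R].
have -> : f @^-1` `]-oo, s[ = \bigcup_n F n.
  rewrite -preimage_bigcup; congr (_ @^-1` _).
  rewrite -setCitvr itvcyEbigcap setC_bigcap.
  by apply: eq_bigcupr => n _; rewrite setCitvr.
have cv : P (F n) @[n --> \oo] --> P (\bigcup_n F n).
  apply: nondecreasing_cvg_mu => [n||m n mn].
  - exact: measurable_funPTI.
  - by apply: bigcup_measurable => ? _; exact: measurable_funPTI.
  - apply/subsetPset; apply: preimage_subset; apply: subset_itvl.
    by rewrite bnd_simp lerD2l lerN2 lef_pV2 ?posrE// ler_nat.
apply: (cvge_to_le cv); apply: nearW => n.
by apply: H; rewrite gtrBl.
Qed.

(** The probability integral transform. The sublevel set [L] of the distribution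
    function is empty, everything, or a half-line ending at [s = sup L]; there
    left continuity gives [cdf f s <= c] and right continuity [c <= cdf f s]. *)
Lemma atomless_cdf_uniform (c : R) : (0 <= c <= 1)%R ->
  P [set x | cdf f (f x) <= c%:E] = c%:E.
Proof.
move=> /andP[c0 c1].
pose L := [set s : R | cdf f s <= c%:E].
have Ldown r s : (r <= s)%R -> L s -> L r.
  by move=> rs; apply: le_trans; exact: cdf_nondecreasing.
have [L0|/set0P[l Ll]] := eqVneq L set0.
  have -> : [set x | cdf f (f x) <= c%:E] = set0.
    by rewrite -subset0 => x Hx; have : L (f x) by []; rewrite L0.
  rewrite measure0; apply/eqP; rewrite eq_le lee_fin c0 /=.
  apply: (cvge_to_ge (cvg_cdfNy0 f)); apply: nearW => s.
  by rewrite leNgt; apply/negP => /ltW cs; have : L s by []; rewrite L0.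
have [ub|nub] := pselect (has_ubound L); last first.
  have LT s : L s.
    apply: contrapT => Ls; apply: nub; exists s => t Lt.
    by rewrite leNgt; apply/negP => st; apply: Ls; apply: Ldown Lt; exact: ltW.
  have -> : [set x | cdf f (f x) <= c%:E] = setT.
    by apply/seteqP; split=> x // _; exact: LT.
  rewrite probability_setT; apply/eqP; rewrite eq_le; apply/andP; split; last by rewrite lee_fin.
  apply: (cvge_to_le (cvg_cdfy1 f)); apply: nearW => s; exact: LT.
have sL : has_sup L by split; [exists l|].
pose s := sup L.
have Ls : L s.
  apply: atomless_cdf_le => r rs.
  have [t Lt rt] := sup_adherent (eps := (s - r)%R) (ltac:(by rewrite subr_gt0)) sL.
  by apply: Ldown Lt; rewrite subKr in rt; exact: ltW.
have -> : [set x | cdf f (f x) <= c%:E] = f @^-1` `]-oo, s].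
  apply/seteqP; split=> x /=; rewrite in_itv/= => H.
    exact: ub_le_sup.
  exact: Ldown Ls.
rewrite -[LHS]/(cdf f s); apply/eqP; rewrite eq_le Ls /=.
apply: (cvge_to_ge (@cdf_right_continuous _ _ _ _ f s)).
near=> r; rewrite leNgt; apply/negP => /ltW Hr.
have /(ub_le_sup ub) : L r by [].
by rewrite leNgt => /negP; apply; near: r; exact: nbhs_right_gt.
Unshelve. all: by end_near. Qed.

End uniformization.

Lemma distribution_cdf_unique d d' (T : measurableType d) (T' : measurableType d')
    (R : realType) (P : probability T R) (P' : probability T' R)
    (f : {RV P >-> R}) (g : {RV P' >-> R}) :
  cdf f =1 cdf g ->
  forall B : set R, measurable B -> P (f @^-1` B) = P' (g @^-1` B).
Proof.
move=> fg B mB; rewrite -[LHS]/(distribution P f B) -[RHS]/(distribution P' g B).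
pose G : set (set R) := [set `]-oo, t]%classic | t in [set: R]].
have mG : measurable = <<s G >>.
  rewrite -[LHS]/(@ocitv R).-sigma.-measurable RGenOInfty.measurableE.
  rewrite eqEsubset; split => A.
    apply: smallest_sub; first exact: smallest_sigma_algebra.
    move=> _ [x ->]; rewrite -setCitvl; apply: sigma_algebraC.
    by apply: sub_sigma_algebra; exists x.
  apply: smallest_sub; first exact: smallest_sigma_algebra.
  move=> _ [x _ <-]; rewrite -setCitvr; apply: sigma_algebraC.
  by apply: sub_sigma_algebra; exists x.
apply: (@measure_unique _ R _ G (fun n => `]-oo, n%:R]%classic) mG) => //.
- move=> _ _ [x _ <-] [y _ <-]; exists (Num.min x y) => //.
  by apply/seteqP; split => z /=; rewrite !in_itv/= le_min => /andP.
- by move=> i; exists i%:R.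
- rewrite -subTset => x _; exists (Num.truncn x).+1 => //=.
  by rewrite in_itv/= ltW// truncnS_gt.
- by move=> _ [t _ <-]; exact: fg.
- by move=> k; rewrite (le_lt_trans (probability_le1 _ _)) ?ltry.
Qed.

(** The map is [V x = inf {t | cdf f (f x) <= cdf g t}], the quantile function of
    [g] at a uniform variable. Restricting [t] to [0, 1], where [g] lives, makes
    this infimum that of a nonempty set bounded below at every point, so that
    for [t] in [0, 1] and every [x], [V x <= t] is equivalent to
    [cdf f (f x) <= cdf g t]. *)
Lemma quantile_transport d d' (T : measurableType d) (T' : measurableType d')
    (R : realType) (P : probability T R) (P' : probability T' R)
    (f : {RV P >-> R}) (g : {RV P' >-> R}) :
  (forall r, P (f @^-1` [set r]) = 0%E) -> (forall x, 0 <= g x <= 1) ->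
  exists2 V : T -> R, measurable_fun setT V &
    forall B : set R, measurable B -> P (V @^-1` B) = P' (g @^-1` B).
Proof.
move=> f0 g01; pose F : R -> \bar R := cdf g.
have F_nd s t : s <= t -> (F s <= F t)%E by exact: cdf_nondecreasing.
have F1 t : 1 <= t -> F t = 1%E.
  move=> t1; rewrite /F /cdf /distribution /pushforward.
  rewrite (_ : _ @^-1` _ = setT) ?probability_setT//.
  apply/seteqP; split => // x _ /=; rewrite in_itv/=.
  by case/andP: (g01 x) => _ /le_trans; apply.
have F0 (t : R) : t < 0 -> F t = 0%E.
  move=> t0; rewrite /F /cdf /distribution /pushforward.
  rewrite (_ : _ @^-1` _ = set0) ?measure0// -subset0 => x /=; rewrite in_itv/=.
  by case/andP: (g01 x) => gx _ gt; move: (le_lt_trans (le_trans gx gt) t0); rewrite ltxx.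
have F_rc (s : R) (c : \bar R) : (forall r, (s < r)%R -> (c <= F r)%E) -> (c <= F s)%E.
  move=> H.
  apply: (cvge_to_ge (@cdf_right_continuous _ _ _ _ g s)).
  by near=> r; apply: H; near: r; exact: nbhs_right_gt.
pose H (x : T) : \bar R := cdf f (f x).
pose A x := [set t : R | (0 <= t <= 1) && (H x <= F t)%E].
pose V x := inf (A x).
have A1 x : A x 1 by rewrite /A/= F1// cdf_le1 lexx ler01.
have A_lb x : has_lbound (A x) by exists 0 => t /andP[/andP[]].
have Ainf x : has_inf (A x) by split => //; exists 1.
have V01 x : 0 <= V x <= 1.
  rewrite ge_inf//= andbT; apply: lb_le_inf; first by exists 1.
  by move=> t /andP[/andP[]].
have VP x (t : R) : 0 <= t <= 1 -> (V x <= t) = (H x <= F t)%E.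
  move=> t01; apply/idP/idP => [Vt|HF]; last by apply: ge_inf => //; rewrite /A/= t01.
  apply: F_rc => r tr.
  have [u /andP[_ Hu] ur] := inf_adherent (eps := r - V x)
    (ltac:(by rewrite subr_gt0 (le_lt_trans Vt))) (Ainf x).
  by apply: le_trans Hu _; apply: F_nd; rewrite ltW// (lt_le_trans ur)// subrKC.
have mH : measurable_fun setT H.
  by apply: measurableT_comp => //; exact: cdf_measurable.
have VE (t : R) : V @^-1` `]-oo, t]%classic = if t < 0 then set0 else if 1 <= t then setT
    else [set x | (H x <= F t)%E].
  apply/seteqP; split => x /=; rewrite in_itv/=.
    move=> Vt; case: ltP => t0.
      by case/andP: (V01 x) => /le_trans /(_ Vt); rewrite leNgt t0.
    by case: leP => //= t1; rewrite -VP// t0 ltW.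
  case: ltP => // t0; case: leP => t1; last by rewrite /= -VP// t0 ltW.
  by case/andP: (V01 x) => _ /le_trans /(_ t1).
have mV : measurable_fun setT V.
  apply: (measurability _ (RGenOInfty.measurableE R)) => //.
  move=> _ [_ [x ->] <-]; rewrite setTI.
  have -> : V @^-1` `]x, +oo[%classic = ~` (V @^-1` `]-oo, x]%classic).
    by rewrite preimage_setC setCitvl.
  apply: measurableC; rewrite VE; case: ifP => // _; case: ifP => // _.
  by rewrite -[X in measurable X]setTI; exact: emeasurable_fun_infty_c.
pose V' : {mfun T >-> R} := HB.pack V (isMeasurableFun.Build _ _ _ _ V mV).
exists V => // B mB.
apply: (@distribution_cdf_unique _ _ _ _ _ P P' V' g) => // t.
transitivity (P (V @^-1` `]-oo, t]%classic)) => //; rewrite VE.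
case: ltP => t0; first by rewrite measure0 -/(F t) F0.
case: leP => t1; first by rewrite probability_setT -/(F t) F1.
have Fin : F t \is a fin_num by rewrite fin_num_measure.
rewrite -/(F t) -(fineK Fin) atomless_cdf_uniform//.
by rewrite fine_ge0//= -lee_fin fineK// probability_le1.
Unshelve. all: by end_near. Qed.

(** * Transport given a countable label *)

(** [quantile_transport] for the conditional probabilities given [A] and [A'];
    both are normalized by the same mass. *)
Lemma restricted_transport d d' (T : measurableType d) (T' : measurableType d')
    (R : realType) (P : probability T R) (P' : probability T' R)
    (f : {RV P >-> R}) (g : {RV P' >-> R}) (A : set T) (A' : set T') :
  (forall r, P (f @^-1` [set r]) = 0%E) -> (forall x, 0 <= g x <= 1) ->
  measurable A -> measurable A' -> P A = P' A' ->
  exists2 V : T -> R, measurable_fun setT V &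
    forall B : set R, measurable B ->
      P (A `&` V @^-1` B) = P' (A' `&` g @^-1` B).
Proof.
move=> f0 g01 mA mA' PA.
have [A0|A0] := eqVneq (P A) 0%E.
  exists (cst 0) => // B mB.
  rewrite (@subset_measure0 _ _ _ P _ A)//; last first.
    by apply: measurableI => //; rewrite -[X in measurable X]setTI; exact: measurable_cst.
  rewrite (@subset_measure0 _ _ _ P' _ A')//; last exact: (etrans (esym PA) A0).
  by apply: measurableI => //; exact: measurable_funPTI.
have Pfin : P A \is a fin_num by rewrite fin_num_measure.
pose PA_ : probability T R := mnormalize (mrestr P mA) P.
pose PA'_ : probability T' R := mnormalize (mrestr P' mA') P'.
have PAE B : PA_ B = (P (B `&` A) * (fine (P A))^-1%:E)%E.
  rewrite /PA_/= /mnormalize/= /mrestr !setTI (negbTE A0) /=.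
  by rewrite (negbTE (_ : P A != +oo%E))//; move: Pfin; rewrite fin_numE => /andP[].
have PAE' B : PA'_ B = (P' (B `&` A') * (fine (P A))^-1%:E)%E.
  rewrite /PA'_/= /mnormalize/= /mrestr !setTI -PA (negbTE A0) /=.
  by rewrite (negbTE (_ : P A != +oo%E))//; move: Pfin; rewrite fin_numE => /andP[].
have [||V mV VE] := @quantile_transport _ _ _ _ R PA_ PA'_ f g => //.
  move=> r; rewrite PAE.
  have mfr : measurable (f @^-1` [set r]) by exact: measurable_funPTI.
  by rewrite (subset_measure0 _ mfr _ (f0 r)) ?mul0e//; exact: measurableI.
exists V => // B mB.
have := VE _ mB; rewrite PAE PAE' ![_ `&` A]setIC ![_ `&` A']setIC.
have a0 : (fine (P A))^-1 != 0 by rewrite invr_eq0 fine_eq0.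
have mAV : measurable (A `&` V @^-1` B).
  by apply: measurableI => //; rewrite -[X in measurable X]setTI; exact: mV.
have mAg : measurable (A' `&` g @^-1` B).
  by apply: measurableI => //; exact: measurable_funPTI.
rewrite -(fineK (fin_num_measure P _ mAV)) -(fineK (fin_num_measure P' _ mAg)).
by rewrite -!EFinM => -[] /(mulIf a0) ->.
Qed.

Lemma measurable_fun_discrete_glue d d' (T : measurableType d) (Z : measurableType d')
    (K : T -> nat) (W : nat -> T -> Z) :
  measurable_fun setT K -> (forall k, measurable_fun setT (W k)) ->
  measurable_fun setT (fun x => W (K x) x).
Proof.
move=> mK mW _ B mB; rewrite setTI.
have -> : (fun x => W (K x) x) @^-1` B = \bigcup_k (K @^-1` [set k] `&` W k @^-1` B).
  by apply/seteqP; split => [x Bx|x [k _ [/= <-]]] //; exists (K x).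
apply: bigcup_measurable => k _; apply: measurableI.
  by rewrite -[X in measurable X]setTI; exact: mK.
by rewrite -[X in measurable X]setTI; exact: mW.
Qed.

Lemma discrete_joint_law d1 d2 d' (T1 : measurableType d1) (T2 : measurableType d2)
    (Z : measurableType d') (R : realType) (P1 : probability T1 R)
    (P2 : probability T2 R) (K1 : T1 -> nat) (K2 : T2 -> nat)
    (V1 : T1 -> Z) (V2 : T2 -> Z) :
  measurable_fun setT K1 -> measurable_fun setT K2 ->
  measurable_fun setT V1 -> measurable_fun setT V2 ->
  (forall k B, measurable B ->
    P1 (K1 @^-1` [set k] `&` V1 @^-1` B) = P2 (K2 @^-1` [set k] `&` V2 @^-1` B)) ->
  forall C : set (nat * Z), measurable C ->
    P1 ((fun x => (K1 x, V1 x)) @^-1` C) = P2 ((fun x => (K2 x, V2 x)) @^-1` C).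
Proof.
move=> mK1 mK2 mV1 mV2 E C mC.
have dec (T : Type) (K : T -> nat) (V : T -> Z) :
    (fun x => (K x, V x)) @^-1` C =
    \bigcup_k (K @^-1` [set k] `&` V @^-1` xsection C k).
  apply/seteqP; split => [x Cx|x [k _ [/= <-]]]; last by rewrite /xsection/= inE.
  by exists (K x) => //; split => //=; rewrite /xsection/= inE.
have mF d (T : measurableType d) (K : T -> nat) (V : T -> Z) k :
    measurable_fun setT K -> measurable_fun setT V ->
    measurable (K @^-1` [set k] `&` V @^-1` xsection C k).
  move=> mK mV; apply: measurableI.
    by rewrite -[X in measurable X]setTI; exact: mK.
  by rewrite -[X in measurable X]setTI; apply: mV => //; exact: measurable_xsection.
have tF (T : Type) (K : T -> nat) (V : T -> Z) :
    trivIset setT (fun k => K @^-1` [set k] `&` V @^-1` xsection C k).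
  by apply/trivIsetP => i j _ _ ij; rewrite -subset0 => x [[/= -> _] [/= ji _]];
    rewrite ji eqxx in ij.
rewrite !dec !measure_bigcup//; try by move=> k _; exact: mF.
apply: eq_eseriesr => k _; apply: E; exact: measurable_xsection.
Qed.

(** Transport given a label: a map [V] is built on each level set of [K]
    separately, so that the pair [(K, V)] has the law of [(K', g)]. *)
Lemma discrete_transport d d' (T : measurableType d) (T' : measurableType d')
    (R : realType) (P : probability T R) (P' : probability T' R)
    (f : {RV P >-> R}) (g : {RV P' >-> R}) (K : T -> nat) (K' : T' -> nat) :
  (forall r, P (f @^-1` [set r]) = 0%E) -> (forall x, 0 <= g x <= 1) ->
  measurable_fun setT K -> measurable_fun setT K' ->
  (forall k, P (K @^-1` [set k]) = P' (K' @^-1` [set k])) ->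
  exists2 V : T -> R, measurable_fun setT V &
    forall C : set (nat * R), measurable C ->
      P ((fun x => (K x, V x)) @^-1` C) = P' ((fun x => (K' x, g x)) @^-1` C).
Proof.
move=> f0 g01 mK mK' KK'.
have mfib d0 (T0 : measurableType d0) (L : T0 -> nat) k :
    measurable_fun setT L -> measurable (L @^-1` [set k]).
  by move=> mL; rewrite -[X in measurable X]setTI; exact: mL.
have /choice[W HW] k : exists V : T -> R, measurable_fun setT V /\
    forall B : set R, measurable B ->
      P (K @^-1` [set k] `&` V @^-1` B) = P' (K' @^-1` [set k] `&` g @^-1` B).
  have [V mV VE] := restricted_transport f0 g01 (mfib _ _ K k mK)
    (mfib _ _ K' k mK') (KK' k).
  by exists V.
have mW := measurable_fun_discrete_glue mK (fun k => (HW k).1).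
exists (fun x => W (K x) x) => //; apply: discrete_joint_law => //.
move=> k B mB; rewrite -(HW k).2//; congr (P _).
by apply/seteqP; split => x [/= <-].
Qed.

(** * A Borel encoding of finite-dimensional space in the unit interval *)

Section ternary.
Variable R : realType.
Implicit Type b : nat -> bool.

Definition ternary_term b : R^nat := fun m => (b m)%:R * (2 / 3 * 3^-1 ^+ m).

(** The point of the Cantor set with ternary digits [2 * b m]. Digits 1 are
    avoided so that the digits of the sum are determined by the sum: the first
    one is read off by comparison with 1/2, and [ternary_shl] drops it. *)
Definition ternary b : R := limn (series (ternary_term b)).

Let geo : series (geometric (2 / 3) (3^-1)) @ \oo --> (1 : R).
Proof.
rewrite [X in _ --> X](_ : 1 = 2 / 3 * (1 - 3^-1)^-1); last by field.
apply: cvg_geometric_series; by rewrite ger0_norm ?invr_ge0// invf_lt1// ltr1n.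
Qed.

Let termge0 b m : 0 <= ternary_term b m.
Proof. by rewrite mulr_ge0// mulr_ge0// exprn_ge0. Qed.

Let termle b m : ternary_term b m <= geometric (2 / 3) (3^-1) m.
Proof.
rewrite /geometric/= /ternary_term; case: (b m); rewrite ?mul1r// mul0r.
by rewrite mulr_ge0// exprn_ge0.
Qed.

Lemma is_cvg_ternary b : cvgn (series (ternary_term b)).
Proof.
apply: (series_le_cvg (termge0 b) _ (termle b)).
  by move=> n; rewrite /geometric/= mulr_ge0// exprn_ge0.
exact: (cvgP _ geo).
Qed.

Lemma ternary_ge0 b : 0 <= ternary b.
Proof.
apply: limr_ge; first exact: is_cvg_ternary.
by apply: nearW => n; rewrite /series/= sumr_ge0.
Qed.

Lemma ternary_le1 b : ternary b <= 1.
Proof.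
rewrite -(cvg_lim _ geo)//; apply: ler_lim.
- exact: is_cvg_ternary.
- exact: (cvgP _ geo).
- by apply: nearW => n; rewrite /series/= ler_sum.
Qed.

Lemma ternary_shift b :
  ternary b = (b 0%N)%:R * (2 / 3) + ternary (fun m => b m.+1) / 3.
Proof.
apply/cvg_lim => //.
rewrite -(cvg_shiftS (series _)).
have -> : [sequence series (ternary_term b) n.+1]_n =
    (fun n => (b 0%N)%:R * (2 / 3) +
       series (ternary_term (fun m => b m.+1)) n / 3) :> R^nat.
  apply/funext => n; rewrite /series/= /ternary_term big_nat_recl// expr0 mulr1; congr (_ + _).
  rewrite mulr_suml; apply: eq_bigr => i _; rewrite exprS; ring.
apply: cvgD; first exact: cvg_cst.
by apply: cvgMl; exact: is_cvg_ternary.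
Qed.

Definition ternary_shl (t : R) : R := if 2^-1 <= t then 3 * t - 2 else 3 * t.

Lemma ternary_bit b : (2^-1 <= ternary b) = b 0%N.
Proof.
have := ternary_ge0 (fun m => b m.+1); have := ternary_le1 (fun m => b m.+1).
rewrite (ternary_shift b); case: (b 0%N) => /= h1 h0; first by rewrite mulr1n mul1r; lra.
by apply/negbTE; rewrite -ltNge mulr0n mul0r; lra.
Qed.

Lemma ternary_shlE b : ternary_shl (ternary b) = ternary (fun m => b m.+1).
Proof.
rewrite /ternary_shl ternary_bit (ternary_shift b); case: (b 0%N) => /=.
  by rewrite mulr1n mul1r; lra.
by rewrite mulr0n mul0r; lra.
Qed.

Lemma ternary_bits b m : (2^-1 <= iter m ternary_shl (ternary b)) = b m.
Proof.
suff -> : iter m ternary_shl (ternary b) = ternary (fun i => b (m + i)%N).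
  by rewrite ternary_bit addn0.
elim: m => //= m ->; rewrite ternary_shlE; congr ternary.
by apply/funext => i; rewrite addSnnS.
Qed.

Lemma measurable_ternary_shl : measurable_fun setT ternary_shl.
Proof.
apply: measurable_fun_ifT => //.
- exact: measurable_fun_ler.
- by apply: measurable_funB => //; exact: measurable_funM.
Qed.

Lemma measurable_ternary d (T : measurableType d) (b : T -> nat -> bool) :
  (forall m, measurable [set x | b x m]) ->
  measurable_fun setT (fun x => ternary (b x)).
Proof.
move=> mb.
apply: (@measurable_fun_cvg _ _ _ _
  (fun n x => series (ternary_term (b x)) n)).
  move=> n; rewrite /series/=; apply: measurable_sum => m.
  apply: measurable_funM => //.
  rewrite (_ : (fun x => _) = \1_[set x | b x m]); first exact: measurable_indic.
  apply/funext => x; rewrite indicE; congr (_%:R); congr nat_of_bool.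
  by apply/idP/idP; rewrite inE.
by move=> x _; exact: is_cvg_ternary.
Qed.

End ternary.

Lemma measurable_coord (R : realType) (n : nat) (i : 'I_n) :
  measurable_fun setT (fun x : borel_rV R n => (x : 'rV[R]_n) ord0 i).
Proof.
apply: (measurability _ (RGenOpens.measurableE R)) => //.
move=> _ [_ [a [b ->]] <-]; rewrite setTI; apply: sub_sigma_algebra.
apply: (@open_comp _ _ (fun x : 'rV[R]_n => x ord0 i)); last exact: itv_open.
by move=> x _; exact: coord_continuous.
Qed.

(** An open set of [R^n] is a countable union of sup-norm balls with rational
    centers and radii 1 / (k + 1), and the preimage of such a ball is a finite
    intersection of conditions on coordinates. *)
Lemma measurable_fun_rV d (T : measurableType d) (R : realType) (n : nat)
    (D : set T) (F : T -> borel_rV R n) :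
  (forall i, measurable_fun D (fun x => (F x : 'rV[R]_n) ord0 i)) ->
  measurable_fun D F.
Proof.
move=> mF mD; apply: (@measurability _ _ T (borel_rV R n) D F (@open 'rV[R]_n)) => //.
move=> _ [U oU <-].
pose c (p : {ffun 'I_n -> rat} * nat) : 'rV[R]_n := \row_j ratr (p.1 j).
pose J := [set p | ball (c p) p.2.+1%:R^-1 `<=` U].
have -> : D `&` F @^-1` U = \bigcup_(p in J) (D `&` F @^-1` (ball (c p) p.2.+1%:R^-1)).
  apply/seteqP; split => [x [Dx Ux]|x [p Jp [Dx Fx]]]; last by split => //; exact: Jp.
  have /nbhs_ballP[e /= e0 eU] : nbhs (F x : 'rV[R]_n) U by exact: open_nbhs_nbhs.
  pose k := Num.truncn (2 / e).
  have ke : k.+1%:R^-1 < e / 2.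
    by rewrite invf_plt ?posrE ?divr_gt0// invf_div truncnS_gt.
  have /choice[q Hq] (j : 'I_n) : exists q : rat,
      ratr q \in `](F x : 'rV[R]_n) ord0 j - k.+1%:R^-1, (F x : 'rV[R]_n) ord0 j + k.+1%:R^-1[.
    by apply: rat_in_itvoo; rewrite ltrBlDr -addrA ltrDl addr_gt0.
  exists (finfun q, k).
    move=> y Hy; apply: eU; split => // i j; have := Hy.2 i j; have := Hq j.
    rewrite /c/= mxE ffunE !ord1 in_itv/= /ball/= => /andP[h1 h2].
    rewrite !ltr_norml => /andP[h3 h4].
    move: ke h1 h2 h3 h4; set a := F x 0 j; set b := y 0 j; set r := ratr _; set dl := _^-1.
    by move=> ? ? ? ? ?; apply/andP; split; lra.
  split => //; split => // i j; have := Hq j; rewrite /c/= mxE ffunE !ord1 in_itv/= /ball/=.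
  move=> /andP[]; rewrite ltr_norml; set a := F x 0 j; set r := ratr _; set dl := _^-1.
  by move=> ? ?; apply/andP; split; lra.
rewrite bigcup_mkcond; apply: countable_bigcupT_measurable; first exact: countableP.
move=> p; case: ifP => // _.
have -> : D `&` F @^-1` ball (c p) p.2.+1%:R^-1 =
    D `&` \bigcap_(j in [set: 'I_n]) (D `&`
      (fun x => (F x : 'rV[R]_n) ord0 j) @^-1` ball (c p ord0 j) p.2.+1%:R^-1).
  apply/seteqP; split => x [Dx Bx]; split => //.
    by move=> j _; split => //; exact: Bx.2.
  by split => // i j; rewrite (ord1 i); exact: (Bx j I).2.
apply: measurableI => //; apply: fin_bigcap_measurable => // j _.
by apply: mF => //; exact: measurable_ball.
Qed.

Section encoding.
Variables (R : realType) (n : nat).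

(** The bits of [x] record on which side of each rational coordinate hyperplane
    it lies; unpickling enumerates these hyperplanes. *)
Definition halfspace_bit (x : 'rV[R]_n) (m : nat) : bool :=
  if unpickle m is Some p then ratr (p : 'I_n * rat).2 < x ord0 p.1 else false.

Definition encode (x : 'rV[R]_n) : R := ternary R (halfspace_bit x).

(** The rationals below the i-th coordinate of the encoded point, as a sequence
    in which [-oo] fills the unused positions; its supremum is the coordinate. *)
Definition decode_coord (i : 'I_n) (t : R) (m : nat) : \bar R :=
  if unpickle m is Some p then
    if ((p : 'I_n * rat).1 == i) && (2^-1 <= iter m (@ternary_shl R) t)
    then (ratr p.2)%:E else -oo%E
  else -oo%E.

Definition decode (t : R) : 'rV[R]_n := \row_i fine (esups (decode_coord i t) 0).

Lemma encodeK : cancel encode decode.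
Proof.
move=> x; apply/rowP => i; rewrite mxE.
suff -> : esups (decode_coord i (encode x)) 0 = (x ord0 i)%:E by [].
have bit m : (2^-1 <= iter m (@ternary_shl R) (encode x)) = halfspace_bit x m.
  exact: ternary_bits.
apply/eqP; rewrite eq_le; apply/andP; split.
  apply: ge_ereal_sup => _ [m _ <-]; rewrite /decode_coord bit /halfspace_bit.
  case: unpickle => [[j q]|]; last by rewrite leNye.
  by case: ifPn => [/andP[/= /eqP <-]|_]; rewrite ?leNye// lee_fin; exact: ltW.
have key (s : R) : s < x ord0 i -> (s%:E <= esups (decode_coord i (encode x)) 0%N)%E.
  move=> /rat_in_itvoo[q]; rewrite in_itv/= => /andP[sq qx].
  apply: (@le_trans _ _ (ratr q)%:E); first by rewrite lee_fin ltW.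
  apply: ereal_sup_ubound; exists (pickle (i, q)) => //.
  by rewrite /decode_coord bit /halfspace_bit pickleK/= eqxx qx.
apply/lee_addgt0Pr => e e0.
by rewrite -leeBlDr//; apply: key; rewrite gtrBl.
Qed.

Lemma encode_ge0_le1 x : 0 <= encode x <= 1.
Proof. by rewrite ternary_ge0 ternary_le1. Qed.

Lemma measurable_encode : measurable_fun setT (encode : borel_rV R n -> R).
Proof.
apply: measurable_ternary => m; rewrite /halfspace_bit.
case: unpickle => [[i q]|/=]; last by rewrite (_ : [set x | _] = set0)//; apply/seteqP; split.
rewrite (_ : [set x | _] =
    [set: borel_rV R n] `&`
    (fun x : borel_rV R n => (x : 'rV[R]_n) ord0 i) @^-1` `]ratr q, +oo[%classic).
  by apply: measurable_coord.
by apply/seteqP; split => x; rewrite /= in_itv/= andbT// => -[].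
Qed.

Lemma measurable_decode : measurable_fun setT (decode : R -> borel_rV R n).
Proof.
apply: measurable_fun_rV => i.
rewrite (_ : (fun x => _) = fine \o (fun t => esups (decode_coord i t) 0)); last first.
  by apply/funext => t; rewrite mxE.
apply: measurableT_comp => //.
apply: measurable_fun_esups => m; rewrite /decode_coord.
case: unpickle => [[j q]/=|]; last exact: measurable_cst.
apply: measurable_fun_ifT => //.
apply: measurable_and => //; apply: measurable_fun_ler => //.
elim: m => [|m IH] /=; first exact: measurable_id.
by apply: measurableT_comp => //; exact: measurable_ternary_shl.
Qed.

End encoding.

(** * The Euclidean norm *)

Section euclidean_norm.
Context {R : realType} {n : nat}.
Implicit Types u v : 'rV[R]_n.

Lemma enorm_ge0 u : 0 <= enorm u.
Proof. exact: sqrtr_ge0. Qed.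

Lemma enorm_sqr u : enorm u ^+ 2 = \sum_(j < n) u ord0 j ^+ 2.
Proof. by rewrite sqr_sqrtr// sumr_ge0// => j _; rewrite sqr_ge0. Qed.

Lemma enormN u : enorm (- u) = enorm u.
Proof. by congr Num.sqrt; apply: eq_bigr => j _; rewrite mxE sqrrN. Qed.

Lemma enormBC u v : enorm (u - v) = enorm (v - u).
Proof. by rewrite -enormN opprB. Qed.

Lemma enorm0 : enorm (0 : 'rV[R]_n) = 0.
Proof.
by rewrite /enorm big1 ?sqrtr0// => j _; rewrite mxE expr0n.
Qed.

Lemma enormZ a u : enorm (a *: u) = `|a| * enorm u.
Proof.
rewrite -[`|a|]sqrtr_sqr -sqrtrM ?sqr_ge0// mulr_sumr; congr Num.sqrt.
by apply: eq_bigr => j _; rewrite mxE exprMn.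
Qed.

Lemma enorm_eq0 u : enorm u = 0 -> u = 0.
Proof.
move=> /(congr1 (fun r => r ^+ 2)); rewrite enorm_sqr expr0n/= => /eqP.
rewrite psumr_eq0 => [|j _]; last exact: sqr_ge0.
move=> /allP u0; apply/rowP => j; apply/eqP.
by have := u0 j (mem_index_enum j); rewrite sqrf_eq0 mxE.
Qed.

(** Cauchy-Schwarz, by adding the inequalities
    [2 * a * b <= (t / s) * a ^ 2 + (s / t) * b ^ 2] with [s = |u|], [t = |v|]. *)
Lemma sum_mul_le_enorm u v : \sum_(j < n) u ord0 j * v ord0 j <= enorm u * enorm v.
Proof.
have [/enorm_eq0->|u0] := eqVneq (enorm u) 0.
  by rewrite enorm0 mul0r big1// => j _; rewrite mxE mul0r.
have [/enorm_eq0->|v0] := eqVneq (enorm v) 0.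
  by rewrite enorm0 mulr0 big1// => j _; rewrite mxE mulr0.
have {}u0 : 0 < enorm u by rewrite lt_def u0 enorm_ge0.
have {}v0 : 0 < enorm v by rewrite lt_def v0 enorm_ge0.
set s := enorm u in u0 *; set t := enorm v in v0 *.
apply: (@le_trans _ _ (\sum_(j < n) ((t / s) * u ord0 j ^+ 2 + (s / t) * v ord0 j ^+ 2) / 2)).
  apply: ler_sum => j _; rewrite -subr_ge0.
  rewrite (_ : _ - _ = (t * u ord0 j - s * v ord0 j) ^+ 2 / (2 * s * t)).
    by rewrite divr_ge0 ?sqr_ge0// !mulr_ge0// ltW.
  by field; rewrite !gt_eqF.
rewrite -mulr_suml big_split/= -!mulr_sumr -!enorm_sqr -/s -/t.
by rewrite le_eqVlt; apply/orP; left; apply/eqP; field; rewrite !gt_eqF.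
Qed.

Lemma enormD u v : enorm (u + v) <= enorm u + enorm v.
Proof.
rewrite -(@ler_pXn2r _ 2)// ?nnegrE ?addr_ge0 ?enorm_ge0//.
rewrite sqrrD !enorm_sqr -[X in _ + X + _]mulr_natl.
rewrite (eq_bigr (fun j =>
    u ord0 j ^+ 2 + 2 * (u ord0 j * v ord0 j) + v ord0 j ^+ 2)); last first.
  by move=> j _; rewrite mxE sqrrD mulr_natl.
rewrite !big_split/= -mulr_sumr lerD2r lerD2l.
by rewrite ler_wpM2l// sum_mul_le_enorm.
Qed.

Lemma enorm_dist_triangle u v w : enorm (u - w) <= enorm (u - v) + enorm (v - w).
Proof. by rewrite (le_trans _ (enormD _ _))// addrA subrK. Qed.

Lemma enorm_sum (I : finType) (F : I -> 'rV[R]_n) :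
  enorm (\sum_i F i) <= \sum_i enorm (F i).
Proof.
apply: (big_ind2 (fun u r => enorm u <= r)) => //; first by rewrite enorm0.
by move=> u r v s ur vs; rewrite (le_trans (enormD _ _))// lerD.
Qed.

Lemma enorm_le_coord (h : R) u : 0 <= h ->
  (forall j, `|u ord0 j| <= h) -> enorm u <= n.+1%:R * h.
Proof.
move=> h0 uh; rewrite -(@ler_pXn2r _ 2)// ?nnegrE ?enorm_ge0 ?mulr_ge0//.
rewrite enorm_sqr exprMn.
apply: (@le_trans _ _ (\sum_(j < n) h ^+ 2)).
  by apply: ler_sum => j _; rewrite -real_normK ?num_real// lerXn2r ?nnegrE.
rewrite sumr_const card_ord -[leLHS]mulr_natl ler_wpM2r ?sqr_ge0//.
by rewrite -natrX ler_nat (leq_trans (leqnSn _))// -{1}[n.+1]expn1 leq_pexp2l.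
Qed.

End euclidean_norm.

(** * The barycentric cost *)

Definition update (I : eqType) (V : Type) (x : I -> V) (i : I) (z : V) : I -> V :=
  fun k => if k == i then z else x k.

Section barycentric_cost.
Context {R : realType} {n N : nat}.
Variable lam : 'I_N -> R.
Hypothesis lam_gt0 : forall i, 0 < lam i.
Hypothesis lam1 : \sum_(i < N) lam i = 1.
Implicit Types x y : 'I_N -> 'rV[R]_n.

Definition barycenter x : 'rV[R]_n := \sum_(i < N) lam i *: x i.

Lemma barycenter_coord x j :
  barycenter x ord0 j = \sum_(i < N) lam i * x i ord0 j.
Proof. by rewrite summxE; apply: eq_bigr => i _; rewrite mxE. Qed.

(** Huygens' formula: the infimum that defines [bary_cost] is attained at the
    barycenter. *)
Lemma weighted_dist_barycenter x (y : 'rV[R]_n) :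
  \sum_(i < N) lam i / 2 * enorm (x i - y) ^+ 2 =
  \sum_(i < N) lam i / 2 * enorm (x i - barycenter x) ^+ 2
  + enorm (y - barycenter x) ^+ 2 / 2.
Proof.
rewrite !enorm_sqr mulr_suml.
under eq_bigr => i _ do rewrite enorm_sqr mulr_sumr.
under [X in _ = X + _]eq_bigr => i _ do rewrite enorm_sqr mulr_sumr.
rewrite exchange_big/= [X in _ = X + _]exchange_big/= -big_split/=.
apply: eq_bigr => j _; rewrite !mxE.
set b := barycenter x ord0 j.
rewrite [LHS](_ : _ = (\sum_(i < N) lam i / 2 * (x i ord0 j - b) ^+ 2)
   + (\sum_(i < N) lam i * x i ord0 j) * (b - y ord0 j)
   + (\sum_(i < N) lam i) * ((y ord0 j ^+ 2 - b ^+ 2) / 2)).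
  under [X in _ = X + _]eq_bigr => i _ do rewrite !mxE -/b.
  by rewrite -barycenter_coord -/b lam1; field.
rewrite !mulr_suml -!big_split/=; apply: eq_bigr => i _.
by rewrite !mxE; field.
Qed.

Lemma bary_costE x :
  bary_cost lam x = \sum_(i < N) lam i / 2 * enorm (x i - barycenter x) ^+ 2.
Proof.
apply/eqP; rewrite eq_le; apply/andP; split.
  apply: ge_inf; last by exists (barycenter x).
  exists 0 => _ [y _ <-]; apply: sumr_ge0 => i _.
  by rewrite mulr_ge0 ?sqr_ge0// divr_ge0// ltW.
apply: lb_le_inf; first by exists (\sum_(i < N) lam i / 2 * enorm (x i - 0) ^+ 2), 0.
move=> _ [y _ <-]; rewrite [leRHS]weighted_dist_barycenter lerDl.
by rewrite divr_ge0// sqr_ge0.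
Qed.

Lemma bary_cost_ge0 x : 0 <= bary_cost lam x.
Proof.
rewrite bary_costE; apply: sumr_ge0 => i _.
by rewrite mulr_ge0 ?sqr_ge0// divr_ge0// ltW.
Qed.

Lemma bary_cost_le x (y : 'rV[R]_n) :
  bary_cost lam x <= \sum_(i < N) lam i / 2 * enorm (x i - y) ^+ 2.
Proof.
by rewrite bary_costE [leRHS]weighted_dist_barycenter lerDl divr_ge0// sqr_ge0.
Qed.

Lemma bary_cost_coord x : bary_cost lam x =
  \sum_(j < n) (\sum_(i < N) lam i * x i ord0 j ^+ 2 - barycenter x ord0 j ^+ 2) / 2.
Proof.
rewrite bary_costE.
under eq_bigr => i _ do rewrite enorm_sqr mulr_sumr.
rewrite exchange_big/=; apply: eq_bigr => j _.
set b := barycenter x ord0 j.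
rewrite [RHS](_ : _ = (\sum_(i < N) lam i * x i ord0 j ^+ 2) / 2
   - (\sum_(i < N) lam i * x i ord0 j) * b + (\sum_(i < N) lam i) * (b ^+ 2 / 2)).
  rewrite !mulr_suml -sumrB -big_split/=; apply: eq_bigr => i _.
  by rewrite !mxE -/b; field.
by rewrite -barycenter_coord -/b lam1; field.
Qed.

Lemma sum_update (F : 'I_N -> 'rV[R]_n -> R) x i z :
  \sum_(k < N) F k (update x i z k) = \sum_(k < N) F k (x k) + (F i z - F i (x i)).
Proof.
rewrite (bigD1 i)//= [in RHS](bigD1 i)//= /update eqxx.
rewrite (eq_bigr (fun k => F k (x k))); first by ring.
by move=> k /negbTE ->.
Qed.

(** On each coordinate the right-hand side minus the left-hand side is half the
    square of [b - b' - l * (s - s')], where [b], [b'] are the coordinates of the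
    barycenters, [s], [s'] those of the exchanged points and [l] their weight. *)
Lemma bary_cost_swap x x' i :
  bary_cost lam (update x i (x' i)) + bary_cost lam (update x' i (x i))
    + lam i ^+ 2 * enorm (x i - x' i) ^+ 2 / 2
  <= bary_cost lam x + bary_cost lam x'
     + enorm (barycenter x - barycenter x') ^+ 2 / 2.
Proof.
rewrite !bary_cost_coord !enorm_sqr mulr_sumr !mulr_suml -!big_split/=.
apply: ler_sum => j _; rewrite !mxE !barycenter_coord.
rewrite !(sum_update (fun k v => lam k * v ord0 j ^+ 2)).
rewrite !(sum_update (fun k v => lam k * v ord0 j)).
set b := \sum_(k < N) lam k * x k ord0 j.
set b' := \sum_(k < N) lam k * x' k ord0 j.
set s := x i ord0 j; set s' := x' i ord0 j; set l := lam i.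
rewrite -subr_ge0 [leRHS](_ : _ = (b - b' - l * (s - s')) ^+ 2 / 2).
  by rewrite divr_ge0// sqr_ge0.
by field.
Qed.

Lemma enorm_sub_barycenter x (z : 'rV[R]_n) (D : R) :
  (forall k, enorm (z - x k) <= D) -> enorm (z - barycenter x) <= D.
Proof.
move=> zD.
have -> : z - barycenter x = \sum_(k < N) lam k *: (z - x k).
  rewrite (eq_bigr (fun k => lam k *: z - lam k *: x k)); last first.
    by move=> k _; rewrite scalerBr.
  by rewrite sumrB -scaler_suml lam1 scale1r.
rewrite (le_trans (enorm_sum _))//.
apply: (@le_trans _ _ (\sum_(k < N) lam k * D)).
  apply: ler_sum => k _; rewrite enormZ gtr0_norm//.
  by rewrite ler_wpM2l// ltW.
by rewrite -mulr_suml lam1 mul1r.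
Qed.

(** Keeping the old barycenter as a trial point for the new configuration only
    changes the i-th term, by
    [lam i / 2 * (|z - b| - |x i - b|) * (|z - b| + |x i - b|)]. *)
Lemma bary_cost_update_le x i (z : 'rV[R]_n) (D : R) :
  (forall k, enorm (z - x k) <= D) -> (forall k, enorm (x i - x k) <= D) ->
  bary_cost lam (update x i z) <= bary_cost lam x + lam i * D * enorm (z - x i).
Proof.
move=> zD xD; rewrite (le_trans (bary_cost_le _ (barycenter x)))//.
rewrite (sum_update (fun k v => lam k / 2 * enorm (v - barycenter x) ^+ 2)).
rewrite bary_costE lerD2l -mulrBr subr_sqr.
have z_b := enorm_sub_barycenter zD; have x_b := enorm_sub_barycenter xD.
have tri : enorm (z - barycenter x) - enorm (x i - barycenter x) <= enorm (z - x i).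
  by rewrite lerBlDr enorm_dist_triangle.
have D0 : 0 <= D by rewrite (le_trans _ z_b)// enorm_ge0.
rewrite -mulrA [D * _]mulrC -mulrA ler_pM2l//.
apply: (@le_trans _ _ (2^-1 * (enorm (z - x i) * (D + D)))).
  rewrite ler_wpM2l ?invr_ge0//.
  apply: (@le_trans _ _ (enorm (z - x i) *
      (enorm (z - barycenter x) + enorm (x i - barycenter x)))).
    by rewrite ler_wpM2r// addr_ge0// enorm_ge0.
  by rewrite ler_wpM2l ?enorm_ge0// lerD.
by rewrite le_eqVlt; apply/orP; left; apply/eqP; field.
Qed.

End barycentric_cost.

(** * Moving a map to another law along a coupling *)

Lemma measurable_fun_nat d (T : measurableType d) (K : T -> nat) :
  (forall k, measurable (K @^-1` [set k])) -> measurable_fun setT K.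
Proof.
move=> mK _ B _; rewrite setTI.
have -> : K @^-1` B = \bigcup_(k in B) (K @^-1` [set k]).
  by apply/seteqP; split => [x Bx|x [k Bk /= ->]] //; exists (K x).
by apply: bigcup_measurable => k _.
Qed.

Lemma measurable_enorm (R : realType) (n : nat) :
  measurable_fun setT (fun x : borel_rV R n => enorm (x : 'rV[R]_n)).
Proof.
apply: (measurableT_comp (continuous_measurable_fun (@sqrt_continuous R))).
apply: measurable_sum => j; apply: measurable_funX; exact: measurable_coord.
Qed.

Lemma measurable_fun_coord d (T : measurableType d) (R : realType) (n : nat)
    (D : set T) (F : T -> borel_rV R n) (i : 'I_n) :
  measurable_fun D F -> measurable_fun D (fun x => (F x : 'rV[R]_n) ord0 i).
Proof. by move=> mF; exact: (measurableT_comp (@measurable_coord R n i) mF). Qed.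

Lemma measurable_fun_enormB d (T : measurableType d) (R : realType) (n : nat)
    (D : set T) (F G : T -> borel_rV R n) :
  measurable_fun D F -> measurable_fun D G ->
  measurable_fun D (fun x => enorm ((F x : 'rV[R]_n) - (G x : 'rV[R]_n))).
Proof.
move=> mF mG.
suff mFG : measurable_fun D (fun x => (F x : 'rV[R]_n) - (G x : 'rV[R]_n) : borel_rV R n).
  exact: (measurableT_comp (@measurable_enorm R n) mFG).
apply: measurable_fun_rV => i.
rewrite (_ : (fun x => _) = (fun x => (F x : 'rV[R]_n) ord0 i - (G x : 'rV[R]_n) ord0 i)).
  by apply: measurable_funB; exact: measurable_fun_coord.
by apply/funext => x; rewrite !mxE.
Qed.

(** The label [q x] codes the cell of a cubic grid that contains [x], and [c k] is
    a marked point of the cell with label [k], if there is such a cell. *)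
Lemma exists_quantizer (R : realType) (n : nat) (e : R) : 0 < e ->
  exists2 q : borel_rV R n -> nat, measurable_fun setT q &
    exists c : nat -> 'rV[R]_n, forall x : 'rV[R]_n, enorm (x - c (q x)) <= e.
Proof.
move=> e0; pose h := e / n.+1%:R.
have h0 : 0 < h by rewrite divr_gt0.
pose cell (x : 'rV[R]_n) : {ffun 'I_n -> int} := [ffun j => Num.floor (x ord0 j / h)].
pose q (x : 'rV[R]_n) : nat := pickle (cell x).
exists q.
  apply: measurable_fun_nat => k.
  have [[p pk]|np] := pselect (exists p : {ffun 'I_n -> int}, pickle p = k); last first.
    rewrite (_ : _ @^-1` _ = set0)// -subset0 => x /= qxk.
    by apply: np; exists (cell x).
  have -> : q @^-1` [set k] = \bigcap_(j in [set: 'I_n])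
      ((fun x : borel_rV R n => (x : 'rV[R]_n) ord0 j) @^-1`
        `[(p j)%:~R * h, (p j + 1)%:~R * h[%classic).
    apply/seteqP; split => [x /= qxk j _ /=|x /= xp].
      have <- : cell x = p by apply: (pcan_inj pickleK); rewrite pk.
      rewrite in_itv/= ffunE -ler_pdivlMr// -ltr_pdivrMr//.
      exact: floor_itv.
    rewrite -pk /q; congr pickle; apply/ffunP => j; rewrite ffunE.
    have := xp j I; rewrite /= in_itv/= -ler_pdivlMr// -ltr_pdivrMr//.
    exact: floor_def.
  apply: fin_bigcap_measurable => // j _.
  by rewrite -[X in measurable X]setTI; exact: measurable_coord.
exists (fun k => xget 0 [set x | q x = k]) => x.
have : q (xget 0 [set y | q y = q x]) = q x.
  exact: (@xgetPex _ 0 [set y | q y = q x] (ex_intro _ x erefl)).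
set y := xget _ _ => /(pcan_inj pickleK) /ffunP yx.
have -> : e = n.+1%:R * h by rewrite /h mulrC divfK.
apply: enorm_le_coord; first exact: ltW.
move=> j; have := yx j; rewrite !ffunE => fyx; rewrite !mxE.
have := floor_itv (y ord0 j / h); have := floor_itv (x ord0 j / h).
rewrite fyx intrD ler_pdivlMr// ltr_pdivrMr// ler_pdivlMr// ltr_pdivrMr//.
rewrite mulrDl mul1r => /andP[a1 a2] /andP[b1 b2]; rewrite ler_norml.
by apply/andP; split; lra.
Qed.

Section rearrangement.
Context d d' {T : measurableType d} {T' : measurableType d'} {R : realType} {n : nat}.
Variables (P : probability T R) (P' : probability T' R) (f : {RV P >-> R}).
Hypothesis f0 : forall r, P (f @^-1` [set r]) = 0%E.

(** [V] is built so that the pair formed by the label of the cell of [U] and [V]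
    has the law of the pair formed by the label of the cell of [X] and [X'].
    The distance from [V] to the marked point of the cell of [U] then has the
    same mean as that from [X'] to the marked point of the cell of [X], and each
    marked point is within [e / 2] of the point it replaces. *)
Lemma rearrangement (U : T -> borel_rV R n) (X X' : T' -> borel_rV R n) (e : R) :
  measurable_fun setT U -> measurable_fun setT X -> measurable_fun setT X' ->
  (forall B, measurable B -> P (U @^-1` B) = P' (X @^-1` B)) -> 0 < e ->
  exists2 V : T -> borel_rV R n, measurable_fun setT V &
   (forall B, measurable B -> P (V @^-1` B) = P' (X' @^-1` B)) /\
   (\int[P]_x (enorm ((V x : 'rV[R]_n) - (U x : 'rV[R]_n)))%:E
     <= \int[P']_x (enorm ((X' x : 'rV[R]_n) - (X x : 'rV[R]_n)))%:E + e%:E)%E.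
Proof.
move=> mU mX mX' UX e0.
have e20 : 0 < e / 2 by rewrite divr_gt0.
have [q mq [c qc]] := exists_quantizer n e20.
pose K := q \o U; pose K' := q \o X.
have mK : measurable_fun setT K by exact: measurableT_comp.
have mK' : measurable_fun setT K' by exact: measurableT_comp.
have mg : measurable_fun setT (fun x => encode (X' x)).
  by apply: measurableT_comp => //; exact: measurable_encode.
pose g : {RV P' >-> R} := HB.pack (fun x => encode (X' x))
  (isMeasurableFun.Build _ _ _ _ _ mg).
have KK' k : P (K @^-1` [set k]) = P' (K' @^-1` [set k]).
  have mqk : measurable (q @^-1` [set k]).
    by rewrite -[X in measurable X]setTI; exact: mq.
  exact: (UX _ mqk).
have [W mW WE] := discrete_transport (g := g) f0 (fun x => encode_ge0_le1 (X' x)) mK mK' KK'.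
pose V : T -> borel_rV R n := fun x => decode n (W x).
have mV : measurable_fun setT V.
  by apply: measurableT_comp => //; exact: measurable_decode.
pose J x := (K x, V x); pose J' x := (K' x, X' x).
have mJ : measurable_fun setT J by exact: measurable_fun_pair.
have mJ' : measurable_fun setT J' by exact: measurable_fun_pair.
have JJ' C : measurable C -> P (J @^-1` C) = P' (J' @^-1` C).
  move=> mC.
  pose C' : set (nat * R) := (fun p : nat * R => (p.1, decode n p.2 : borel_rV R n)) @^-1` C.
  have -> : J @^-1` C = (fun x => (K x, W x)) @^-1` C' by [].
  have -> : J' @^-1` C = (fun x => (K' x, g x)) @^-1` C'.
    by apply/seteqP; split => x; rewrite /C'/= encodeK.
  apply: WE; rewrite /C' -[X in measurable X]setTI.
  apply: measurable_fun_pair => //.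
  by apply: measurableT_comp => //; exact: measurable_decode.
have mPhi : measurable_fun setT
    (fun z : nat * borel_rV R n => (enorm ((z.2 : 'rV[R]_n) - c z.1))%:E).
  apply/measurable_EFinP.
  apply: (@measurable_fun_discrete_glue _ _ _ _ fst
    (fun k (z : nat * borel_rV R n) => enorm ((z.2 : 'rV[R]_n) - c k))).
    exact: measurable_fst.
  move=> k; apply: measurable_fun_enormB; first exact: measurable_snd.
  exact: measurable_cst.
have intJ : (\int[P]_x (enorm ((V x : 'rV[R]_n) - c (K x)))%:E =
    \int[P']_x (enorm ((X' x : 'rV[R]_n) - c (K' x)))%:E)%E.
  pose Phi := fun z : nat * borel_rV R n => (enorm ((z.2 : 'rV[R]_n) - c z.1))%:E.
  have Phi0 z : (0 <= Phi z)%E by rewrite lee_fin enorm_ge0.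
  have -> : (fun x => (enorm ((V x : 'rV[R]_n) - c (K x)))%:E) = Phi \o J by [].
  have -> : (fun x => (enorm ((X' x : 'rV[R]_n) - c (K' x)))%:E) = Phi \o J' by [].
  rewrite -[LHS](ge0_integral_pushforward mJ P measurableT mPhi (fun z _ => Phi0 z)).
  rewrite -[RHS](ge0_integral_pushforward mJ' P' measurableT mPhi (fun z _ => Phi0 z)).
  by apply: eq_measure_integral => C mC _; exact: JJ'.
exists V => //; split.
  move=> B mB; have := JJ' (setT `*` B) (measurableX measurableT mB).
  have -> : J @^-1` (setT `*` B) = V @^-1` B by apply/seteqP; split => x //= [].
  by have -> : J' @^-1` (setT `*` B) = X' @^-1` B by apply/seteqP; split => x //= [].
have mc d0 (T0 : measurableType d0) (L : T0 -> nat) : measurable_fun setT L ->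
    measurable_fun setT (fun x => c (L x) : borel_rV R n).
  move=> mL; apply: (@measurable_fun_discrete_glue _ _ _ _ L
    (fun k _ => c k : borel_rV R n)) => // k.
have addcst d0 (T0 : measurableType d0) (Q : probability T0 R) (F : T0 -> R) (a : R) :
    measurable_fun setT F -> (forall x, 0 <= F x) -> 0 <= a ->
    (\int[Q]_x (F x + a)%:E = \int[Q]_x (F x)%:E + a%:E)%E.
  move=> mF F0 a0; under eq_integral do rewrite EFinD.
  transitivity (\int[Q]_x (F x)%:E + \int[Q]_x a%:E)%E.
    apply: ge0_integralD => //; first by move=> x _; rewrite lee_fin.
    exact/measurable_EFinP.
  by rewrite integral_cst// [X in (_ * X)%E]probability_setT mule1.
apply: (@le_trans _ _ (\int[P]_x (enorm ((V x : 'rV[R]_n) - c (K x)) + e / 2)%:E)%E).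
  apply: ge0_le_integral => //.
  - by move=> x _; rewrite lee_fin enorm_ge0.
  - by apply/measurable_EFinP; exact: measurable_fun_enormB.
  - apply/measurable_EFinP; apply: measurable_funD => //.
    by apply: measurable_fun_enormB => //; exact: mc.
  - move=> x _; rewrite lee_fin (le_trans (enorm_dist_triangle _ (c (K x)) _))//.
    by rewrite lerD2l enormBC; exact: qc.
rewrite (addcst _ _ _ _ _ (measurable_fun_enormB mV (mc _ _ _ mK))
  (fun x => enorm_ge0 _) (ltW e20)).
have -> : e%:E = ((e / 2)%:E + (e / 2)%:E)%E by rewrite -EFinD -splitr.
rewrite intJ addeA leeD2r//.
rewrite -(addcst _ _ _ _ _ (measurable_fun_enormB mX' mX)
  (fun x => enorm_ge0 _) (ltW e20)).
apply: ge0_le_integral => //.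
- by move=> x _; rewrite lee_fin enorm_ge0.
- by apply/measurable_EFinP; apply: measurable_fun_enormB => //; exact: mc.
- by apply/measurable_EFinP; apply: measurable_funD => //; exact: measurable_fun_enormB.
- by move=> x _; rewrite lee_fin (le_trans (enorm_dist_triangle _ (X x) _))// lerD2l; exact: qc.
Qed.

End rearrangement.

(** * Transport maps between compact sets *)

Lemma lebesgue_rV_set0 (R : realType) (n : nat) : @lebesgue_rV R n set0 = 0%E.
Proof.
elim: n => [|n IH] /=; first by rewrite indic0.
by rewrite [X in integral _ _ X](_ : _ = cst 0%E) ?integral0//; exact/funext.
Qed.

(** The slices of [B] are empty except at [r], a single point. *)
Lemma lebesgue_rV_hyperplane (R : realType) (n : nat) (r : R) (B : set 'rV[R]_n.+1) :
  B `<=` [set x | x ord0 ord0 = r] -> @lebesgue_rV R n.+1 B = 0%E.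
Proof.
move=> Br; change (\int[@lebesgue_measure R]_t
  lebesgue_rV [set v : 'rV[R]_n | B (row_mx (t%:M : 'rV[R]_1) v)] = 0)%E.
set h := fun t : R => _.
have h0 t : t != r -> h t = 0%E.
  move=> tr; rewrite /h (_ : [set v | _] = set0) ?lebesgue_rV_set0// -subset0.
  move=> v /Br; rewrite /mkset.
  have -> : (row_mx (t%:M : 'rV[R]_1) v : 'rV[R]_n.+1) ord0 ord0 = t.
    transitivity (row_mx (t%:M : 'rV[R]_1) v ord0 (lshift n (ord0 : 'I_1))).
      by congr (row_mx _ _ _ _); exact/val_inj.
    by rewrite row_mxEl mxE eqxx mulr1n.
  by move=> /eqP; rewrite (negbTE tr).
have mh : measurable_fun setT h.
  rewrite (_ : h = fun t => if t == r then h r else 0%E).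
    apply: measurable_fun_ifT => //; exact: measurable_fun_eqr.
  by apply/funext => t; case: eqVneq => [->|/h0].
rewrite -(@integral_setD1 R h r setT)//; last first.
- exact: measurable_funTS.
- exact: measurableD.
by apply: integral0_eq => t [_ /eqP]; exact: h0.
Qed.

Lemma ac_hyperplane0 (R : realType) (n : nat) (S : set 'rV[R]_n.+1)
    (rho : probability (borel_rV R n.+1) R) (r : R) :
  prob_ac_on S rho ->
  rho ((fun x : borel_rV R n.+1 => (x : 'rV[R]_n.+1) ord0 ord0) @^-1` [set r]) = 0%E.
Proof.
move=> [_ ac]; set H := _ @^-1` _.
have mH : measurable H.
  by rewrite -[X in measurable X]setTI; exact: measurable_coord.
by apply: (ac H) => // B _ BH; exact: (@lebesgue_rV_hyperplane R n r).
Qed.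

Lemma measurable_compact_rV (R : realType) (n : nat) (S : set 'rV[R]_n) :
  compact S -> measurable (S : set (borel_rV R n)).
Proof.
move=> cS; rewrite -[S]setCK; apply: measurableC; apply: sub_sigma_algebra.
by apply: closed_openC; apply: compact_closed => //; exact: norm_hausdorff.
Qed.

Lemma enorm_le_ediam (R : realType) (n : nat) (A : set 'rV[R]_n) (x y : 'rV[R]_n) :
  compact A -> A x -> A y -> enorm (x - y) <= ediam A.
Proof.
move=> /compact_bounded[M [_ HM]] Ax Ay; apply: ub_le_sup; last by exists (x, y).
exists (n.+1%:R * ((`|M| + 1) + (`|M| + 1))) => _ [[a b] [/= Aa Ab] <-].
have Mlt : M < `|M| + 1 by rewrite (le_lt_trans (ler_norm M))// ltrDl.
apply: enorm_le_coord; first by rewrite !addr_ge0.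
have coord (z : 'rV[R]_n) (j : 'I_n) : A z -> `|z ord0 j| <= `|M| + 1.
  move=> Az; apply: le_trans (HM _ Mlt _ Az).
  rewrite [leRHS]mx_normrE.
  exact: (le_bigmax _ (fun ij : 'I_1 * 'I_n => `|z ij.1 ij.2|) (ord0, j)).
by move=> j; rewrite !mxE (le_trans (ler_normB _ _))// lerD// coord.
Qed.

Lemma L2normE (R : realType) (n : nat) (S : set 'rV[R]_n)
    (rho : probability (borel_rV R n) R) (F : 'rV[R]_n -> 'rV[R]_n) :
  L2norm S rho F =
  ((\int[rho]_(x in (S : set (borel_rV R n))) (enorm (F x) ^+ 2)%:E) `^ 2^-1)%E.
Proof.
rewrite /L2norm unlock; congr (_ `^ _)%E; rewrite [RHS]integral_mkcond.
apply: eq_integral => x _; rewrite /patch /=; case: ifPn => _ /=.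
  by rewrite ger0_norm ?enorm_ge0// powR_mulrn ?enorm_ge0.
by rewrite normr0 powR0.
Qed.

Section full_measure.
Context d {T : measurableType d} {R : realType} (P : probability T R).

Lemma probability_setI_full (S A : set T) : measurable S -> measurable A ->
  P S = 1%E -> P (S `&` A) = P A.
Proof.
move=> mS mA S1.
have C0 : P (~` S) = 0%E by rewrite probability_setC// S1 subee.
have mC := measurableC mS.
have D0 : P (A `&` ~` S) = 0%E.
  by apply: (subset_measure0 _ mC _ C0) => //; exact: measurableI.
by rewrite (measureDI P mA mS) setDE [X in (X + _)%E]D0 add0e setIC.
Qed.

End full_measure.

Lemma measurable_fun_default d d' (T : measurableType d) (Z : measurableType d')
    (S : set T) (F : T -> Z) (z : Z) :
  measurable S -> measurable_fun S F ->
  measurable_fun setT (fun x => if x \in S then F x else z).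
Proof.
move=> mS mF; rewrite -(setUv S).
apply/measurable_funU => //; [exact: measurableC|split].
  by apply: eq_measurable_fun mF => x xS; rewrite xS.
apply: (eq_measurable_fun (cst z)); last exact: measurable_cst.
by move=> x; rewrite inE => /= xS; rewrite memNset.
Qed.

(** [rearrangement] for maps from [S] to [Y]: [F] is extended by a point of [Y]
    outside [S], and the values of the new map outside [Y], which are taken with
    probability 0, are moved to that point. *)
Lemma transport_rearrangement (R : realType) (n : nat) (S Y : set 'rV[R]_n)
    (rho mu nu : probability (borel_rV R n) R) (f : {RV rho >-> R})
    (F : 'rV[R]_n -> 'rV[R]_n) d (O : measurableType d) (P : probability O R)
    (X X' : O -> borel_rV R n) (e : R) :
  (forall r, rho (f @^-1` [set r]) = 0%E) ->
  measurable (S : set (borel_rV R n)) -> measurable (Y : set (borel_rV R n)) ->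
  prob_on S rho -> prob_on Y mu -> transport_map S Y rho nu F ->
  measurable_fun setT X -> measurable_fun setT X' ->
  (forall B, measurable B -> P (X @^-1` B) = nu B) ->
  (forall B, measurable B -> P (X' @^-1` B) = mu B) -> 0 < e ->
  exists2 V, transport_map S Y rho mu V &
    (\int[rho]_(x in (S : set (borel_rV R n))) (enorm (V x - F x))%:E
     <= \int[P]_x (enorm ((X' x : 'rV[R]_n) - (X x : 'rV[R]_n)))%:E + e%:E)%E.
Proof.
move=> f0 mS mY S1 Y1 [mF SF Fnu] mX mX' Xnu X'mu e0.
have [y0 Yy0] : Y !=set0.
  apply/set0P/negP => /eqP Y0; move: Y1; rewrite /prob_on Y0 measure0 => /eqP.
  by rewrite eqe eq_sym oner_eq0.
pose U : borel_rV R n -> borel_rV R n := fun x => if x \in S then F x else y0.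
have mU : measurable_fun setT U by exact: measurable_fun_default.
have US x : S x -> U x = F x by move=> Sx; rewrite /U mem_set.
pose ret : borel_rV R n -> borel_rV R n := fun y => if y \in Y then y else y0.
have mret : measurable_fun setT ret.
  by apply: measurable_fun_default => //; exact: measurable_id.
have mpre d0 (T0 : measurableType d0) (G : T0 -> borel_rV R n) B :
    measurable_fun setT G -> measurable B -> measurable (G @^-1` B).
  by move=> mG mB; rewrite -[X in measurable X]setTI; exact: mG.
have UX B : measurable B -> rho (U @^-1` B) = P (X @^-1` B).
  move=> mB; rewrite Xnu// -Fnu// -(probability_setI_full mS (mpre _ _ _ _ mU mB) S1).
  by congr (rho _); apply/seteqP; split => x [Sx]; rewrite /= US.
have [W mW [Wmu WI]] := rearrangement f0 mU mX mX' UX e0.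
pose V : borel_rV R n -> borel_rV R n := ret \o W.
have mV : measurable_fun setT V by exact: measurableT_comp.
exists V.
  split; first exact: measurable_funTS.
    by move=> x _; rewrite /V/= /ret; case: ifPn => //; rewrite inE.
  move=> A mA; rewrite probability_setI_full//; last exact: mpre.
  rewrite -[V @^-1` A]/(W @^-1` (ret @^-1` A)) Wmu; last exact: mpre.
  rewrite X'mu; last exact: mpre.
  rewrite -(probability_setI_full mY (mpre _ _ _ _ mret mA) Y1).
  rewrite -[RHS](probability_setI_full mY mA Y1); congr (mu _).
  by apply/seteqP; split => y [Yy]; rewrite /= /ret mem_set.
apply: le_trans WI.
have -> : (\int[rho]_(x in (S : set (borel_rV R n))) (enorm (V x - F x))%:E =
   \int[rho]_(x in (S : set (borel_rV R n))) (enorm ((V x : 'rV[R]_n) - (U x : 'rV[R]_n)))%:E)%E.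
  by apply: eq_integral => x; rewrite inE => Sx; rewrite US.
apply: (@le_trans _ _ (\int[rho]_x (enorm ((V x : 'rV[R]_n) - (U x : 'rV[R]_n)))%:E)%E).
  apply: ge0_subset_integral => //.
  - by apply/measurable_EFinP; exact: measurable_fun_enormB.
  - by move=> x _; rewrite lee_fin enorm_ge0.
rewrite le_eqVlt; apply/orP; left; apply/eqP.
apply: ge0_ae_eq_integral => //.
- by apply/measurable_EFinP; exact: measurable_fun_enormB.
- by apply/measurable_EFinP; exact: measurable_fun_enormB.
- by move=> x _; rewrite lee_fin enorm_ge0.
- by move=> x _; rewrite lee_fin enorm_ge0.
exists (W @^-1` (~` Y)); split.
- by apply: mpre => //; exact: measurableC.
- have mYC := measurableC mY.
  apply: (etrans (Wmu _ mYC)); rewrite (X'mu _ mYC).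
  by rewrite probability_setC// Y1 subee.
- move=> x /= nWV Yx; apply: nWV => _.
  by rewrite /V/= /ret mem_set.
Qed.

(** * Stability of optimal families *)

Section measurability.
Context d {T : measurableType d} {R : realType} {n N : nat}.
Variables (lam : 'I_N -> R) (D : set T) (g : T -> 'I_N -> 'rV[R]_n).
Hypothesis mg : forall k, measurable_fun D (fun x => g x k : borel_rV R n).

Lemma measurable_barycenter_coord j :
  measurable_fun D (fun x => barycenter lam (g x) ord0 j).
Proof.
rewrite (_ : (fun x => _) = fun x => \sum_(k < N) lam k * g x k ord0 j).
  apply: measurable_sum => k; apply: measurable_funM; first exact: measurable_cst.
  exact: measurable_fun_coord (mg k).
by apply/funext => x; rewrite barycenter_coord.
Qed.

Lemma measurable_barycenter :
  measurable_fun D (fun x => barycenter lam (g x) : borel_rV R n).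
Proof. by apply: measurable_fun_rV => j; exact: measurable_barycenter_coord. Qed.

Lemma measurable_bary_cost : (forall i, 0 < lam i) -> \sum_(i < N) lam i = 1 ->
  measurable_fun D (fun x => bary_cost lam (g x)).
Proof.
move=> lam_gt0 lam1; under eq_fun do rewrite bary_cost_coord//.
apply: measurable_sum => j; apply: measurable_funM; last exact: measurable_cst.
apply: measurable_funB.
  apply: measurable_sum => k; apply: measurable_funM; first exact: measurable_cst.
  by apply: measurable_funX; exact: measurable_fun_coord (mg k).
by apply: measurable_funX; exact: measurable_barycenter_coord.
Qed.

End measurability.

Section stability.
Context {R : realType} {n N : nat} (lam : 'I_N -> R) (S Y : set 'rV[R]_n) (D : R)
  (rho : probability (borel_rV R n) R) (f : {RV rho >-> R}).
Hypothesis lam_gt0 : forall i, 0 < lam i.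
Hypothesis lam1 : \sum_(i < N) lam i = 1.
Hypothesis D_gt0 : 0 < D.
Hypothesis diamD : forall a b, (S `|` Y) a -> (S `|` Y) b -> enorm (a - b) <= D.
Hypothesis mS : measurable (S : set (borel_rV R n)).
Hypothesis mY : measurable (Y : set (borel_rV R n)).
Hypothesis S1 : prob_on S rho.
Hypothesis f0 : forall r, rho (f @^-1` [set r]) = 0%E.
Implicit Types (mu : 'I_N -> probability (borel_rV R n) R)
  (T : 'I_N -> 'rV[R]_n -> 'rV[R]_n).

Lemma with_id_SY mu T x k : mm_transport_maps S Y rho mu T -> S x ->
  (S `|` Y) (with_id T x k).
Proof.
move=> TT Sx; rewrite /with_id; case: ifPn => [k0|_]; last by left.
by right; case: (TT k k0) => _ + _; apply.
Qed.

Lemma measurable_with_id mu T k : mm_transport_maps S Y rho mu T ->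
  measurable_fun (S : set (borel_rV R n)) (fun x => with_id T x k : borel_rV R n).
Proof.
move=> TT; rewrite /with_id; have [k0|_] := boolP (0 < k)%N.
  by case: (TT k k0).
exact: measurable_id.
Qed.

Lemma measurable_update_with_id mu T i (F : 'rV[R]_n -> 'rV[R]_n) k :
  mm_transport_maps S Y rho mu T ->
  measurable_fun (S : set (borel_rV R n)) (F : borel_rV R n -> borel_rV R n) ->
  measurable_fun (S : set (borel_rV R n))
    (fun x => update (with_id T x) i (F x) k : borel_rV R n).
Proof.
move=> TT mF; rewrite /update; have [_|_] := boolP (k == i) => //.
exact: (measurable_with_id _ TT).
Qed.

(** The family [T] with [F] in place of [T i] has a wrong i-th marginal, [nu]
    instead of [mu i]; correcting [F] along a coupling [(X, X')] of [nu] and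
    [mu i] makes it a competitor of [T]. *)
Lemma optimal_cost_le_update mu T (i : 'I_N) (nu : probability (borel_rV R n) R)
    (F : 'rV[R]_n -> 'rV[R]_n)
    d (O : measurableType d) (P : probability O R) (X X' : O -> borel_rV R n) :
  (0 < i)%N -> mm_optimal_maps lam S Y rho mu T -> prob_on Y (mu i) ->
  transport_map S Y rho nu F ->
  measurable_fun setT X -> measurable_fun setT X' ->
  (forall B, measurable B -> P (X @^-1` B) = nu B) ->
  (forall B, measurable B -> P (X' @^-1` B) = mu i B) ->
  (mm_monge_cost lam S rho T <=
    \int[rho]_(x in (S : set (borel_rV R n))) (bary_cost lam (update (with_id T x) i (F x)))%:E
    + (lam i * D)%:E * \int[P]_x (enorm ((X' x : 'rV[R]_n) - (X x : 'rV[R]_n)))%:E)%E.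
Proof.
move=> i0 [TT Topt] Ymu TF mX mX' Xnu X'mu.
have lD0 : 0 < lam i * D by rewrite mulr_gt0.
have mF : measurable_fun (S : set (borel_rV R n)) (F : borel_rV R n -> borel_rV R n) by case: TF.
apply/lee_addgt0Pr => e e0.
have e'0 : 0 < e / (lam i * D) by rewrite divr_gt0.
have [V TV VI] := transport_rearrangement f0 mS mY S1 Ymu TF mX mX' Xnu X'mu e'0.
have mV : measurable_fun (S : set (borel_rV R n)) (V : borel_rV R n -> borel_rV R n) by case: TV.
pose TU := update T i V.
have TTU : mm_transport_maps S Y rho mu TU.
  by move=> k k0; rewrite /TU /update; case: eqP => [->|_] //; exact: TT.
have widU x : with_id TU x = update (with_id T x) i (V x).
  apply/funext => k; rewrite /with_id /TU /update.
  by case: eqP => [->|_] //; rewrite i0.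
apply: (le_trans (Topt _ TTU)).
rewrite /mm_monge_cost.
have W0 : (0 <= \int[P]_x (enorm ((X' x : 'rV[R]_n) - (X x : 'rV[R]_n)))%:E)%E.
  by apply: integral_ge0 => x _; rewrite lee_fin enorm_ge0.
have -> : (e%:E = (lam i * D)%:E * (e / (lam i * D))%:E)%E.
  by rewrite -EFinM mulrC divfK ?gt_eqF.
rewrite -addeA -ge0_muleDr//; last by rewrite lee_fin ltW.
have mcU : measurable_fun (S : set (borel_rV R n))
    (fun x => (bary_cost lam (update (with_id T x) i (F x)))%:E).
  apply/measurable_EFinP.
  have mU k := measurable_update_with_id i k TT mF.
  exact: (measurable_bary_cost mU lam_gt0 lam1).
have mVF : measurable_fun (S : set (borel_rV R n)) (fun x => (enorm (V x - F x))%:E).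
  by apply/measurable_EFinP; exact: measurable_fun_enormB.
apply: (@le_trans _ _ (\int[rho]_(x in (S : set (borel_rV R n)))
   ((bary_cost lam (update (with_id T x) i (F x)))%:E
    + (lam i * D)%:E * (enorm (V x - F x))%:E))%E).
  apply: ge0_le_integral => //.
  - by move=> x _; rewrite lee_fin bary_cost_ge0.
  - apply/measurable_EFinP.
    exact: (measurable_bary_cost (fun k => measurable_with_id k TTU) lam_gt0 lam1).
  - by apply: emeasurable_funD => //; apply: measurable_funeM.
  - move=> x Sx; rewrite -EFinM -EFinD lee_fin widU.
    have -> : update (with_id T x) i (V x) = update (update (with_id T x) i (F x)) i (V x).
      by apply/funext => k; rewrite /update; case: eqP.
    have FY : Y (F x) by case: TF => _ + _; apply.
    have VY : Y (V x) by case: TV => _ + _; apply.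
    have inSY k : (S `|` Y) (update (with_id T x) i (F x) k).
      by rewrite /update; case: eqP => _; [right|exact: (with_id_SY _ TT Sx)].
    set u := update (with_id T x) i (F x) in inSY *.
    have uE : u i = F x by rewrite /u /update eqxx.
    rewrite -uE; apply: bary_cost_update_le => // k; apply: diamD => //.
    by right.
rewrite [leLHS](_ : _ = \int[rho]_(x in (S : set (borel_rV R n)))
      (bary_cost lam (update (with_id T x) i (F x)))%:E
    + (lam i * D)%:E *
      \int[rho]_(x in (S : set (borel_rV R n))) (enorm (V x - F x))%:E)%E.
  by rewrite leeD2l// lee_pmul2l// lte_fin.
rewrite -ge0_integralZl_EFin//; last 2 first.
- by move=> x _; rewrite lee_fin enorm_ge0.
- exact: ltW.
apply: ge0_integralD => //.
- by move=> x _; rewrite lee_fin bary_cost_ge0.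
- by move=> x _; rewrite mule_ge0// lee_fin ?enorm_ge0// ltW.
- exact: measurable_funeM.
Qed.

Lemma ge0_bounded_integralE (g : 'rV[R]_n -> R) (M : R) :
  measurable_fun (S : set (borel_rV R n)) (g : borel_rV R n -> R) ->
  (forall x, S x -> 0 <= g x <= M) ->
  exists2 r : R, 0 <= r &
    (\int[rho]_(x in (S : set (borel_rV R n))) (g x)%:E = r%:E)%E.
Proof.
move=> mg gM.
have ge0 : (0 <= \int[rho]_(x in (S : set (borel_rV R n))) (g x)%:E)%E.
  by apply: integral_ge0 => x /gM/andP[g0 _]; rewrite lee_fin.
have leM : (\int[rho]_(x in (S : set (borel_rV R n))) (g x)%:E <= M%:E)%E.
  have -> : M%:E = (\int[rho]_(x in (S : set (borel_rV R n))) M%:E)%E.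
    by rewrite integral_cst// [X in (_ * X)%E]S1 mule1.
  apply: ge0_le_integral => //.
  - by move=> x /gM/andP[g0 _]; rewrite lee_fin.
  - exact/measurable_EFinP.
  - by move=> x /gM/andP[_ gxM]; rewrite lee_fin.
have fin : (\int[rho]_(x in (S : set (borel_rV R n))) (g x)%:E)%E \is a fin_num.
  by rewrite ge0_fin_numE// (le_lt_trans leM)// ltry.
by exists (fine (\int[rho]_(x in (S : set (borel_rV R n))) (g x)%:E)%E); rewrite ?fine_ge0 ?fineK.
Qed.

Lemma bary_cost_le_diam (x : 'I_N -> 'rV[R]_n) (i : 'I_N) :
  (forall k, (S `|` Y) (x k)) -> bary_cost lam x <= D ^+ 2 / 2.
Proof.
move=> xSY; apply: (le_trans (bary_cost_le lam_gt0 lam1 x (x i))).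
apply: (@le_trans _ _ (\sum_(k < N) lam k * (D ^+ 2 / 2))).
  apply: ler_sum => k _; rewrite mulrAC -mulrA ler_wpM2l ?(ltW (lam_gt0 _))//.
  rewrite ler_wpM2r ?invr_ge0// lerXn2r ?nnegrE ?enorm_ge0 ?(ltW D_gt0)//.
  exact: diamD.
by rewrite -mulr_suml lam1 mul1r.
Qed.

Section two_problems.
Variables (mu mu' : 'I_N -> probability (borel_rV R n) R).
Variables (T T' : 'I_N -> 'rV[R]_n -> 'rV[R]_n) (i : 'I_N).
Hypothesis i0 : (0 < i)%N.
Hypothesis Tmu : mm_optimal_maps lam S Y rho mu T.
Hypothesis Tmu' : mm_optimal_maps lam S Y rho mu' T'.
Hypothesis Ymu : prob_on Y (mu i).
Hypothesis Ymu' : prob_on Y (mu' i).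

Local Notation U x := (update (with_id T x) i (T' i x)).
Local Notation U' x := (update (with_id T' x) i (T i x)).

Let with_idi (V : 'I_N -> 'rV[R]_n -> 'rV[R]_n) x : with_id V x i = V i x.
Proof. by rewrite /with_id i0. Qed.

Let TSY x k : S x -> (S `|` Y) (with_id T x k).
Proof. by move=> Sx; apply: with_id_SY Sx; case: Tmu => + _; exact. Qed.

Let TSY' x k : S x -> (S `|` Y) (with_id T' x k).
Proof. by move=> Sx; apply: with_id_SY Sx; case: Tmu' => + _; exact. Qed.

Let mTi : measurable_fun (S : set (borel_rV R n)) (T i : borel_rV R n -> borel_rV R n).
Proof. by case: Tmu => /(_ i i0)[]. Qed.

Let mTi' : measurable_fun (S : set (borel_rV R n)) (T' i : borel_rV R n -> borel_rV R n).
Proof. by case: Tmu' => /(_ i i0)[]. Qed.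

Let mwT k := measurable_with_id k Tmu.1.
Let mwT' k := measurable_with_id k Tmu'.1.

Lemma integral_dist_finite : exists2 a : R, 0 <= a &
  (\int[rho]_(x in (S : set (borel_rV R n))) (enorm (T i x - T' i x) ^+ 2)%:E = a%:E)%E.
Proof.
apply: (@ge0_bounded_integralE _ (D ^+ 2)).
  by apply: measurable_funX; exact: measurable_fun_enormB.
move=> x Sx; rewrite sqr_ge0/= lerXn2r ?nnegrE ?enorm_ge0 ?(ltW D_gt0)//.
rewrite -!with_idi; apply: diamD; [exact: TSY|exact: TSY'].
Qed.

Lemma integral_bary_finite : exists2 b : R, 0 <= b &
  (\int[rho]_(x in (S : set (borel_rV R n)))
     (enorm (bary_map lam T x - bary_map lam T' x) ^+ 2)%:E = b%:E)%E.
Proof.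
apply: (@ge0_bounded_integralE _ (D ^+ 2)).
  apply: measurable_funX; apply: measurable_fun_enormB.
    exact: (measurable_barycenter lam mwT).
  exact: (measurable_barycenter lam mwT').
move=> x Sx; rewrite sqr_ge0/= lerXn2r ?nnegrE ?enorm_ge0 ?(ltW D_gt0)//.
apply: (enorm_sub_barycenter lam_gt0 lam1) => k.
rewrite enormBC; apply: (enorm_sub_barycenter lam_gt0 lam1) => l.
by apply: diamD; [exact: TSY'|exact: TSY].
Qed.

Let mU k := measurable_update_with_id i k Tmu.1 mTi'.
Let mU' k := measurable_update_with_id i k Tmu'.1 mTi.

Lemma integral_bary_cost_swap :
  (\int[rho]_(x in (S : set (borel_rV R n))) (bary_cost lam (U x))%:E +
   \int[rho]_(x in (S : set (borel_rV R n))) (bary_cost lam (U' x))%:E +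
   (lam i ^+ 2 / 2)%:E *
     \int[rho]_(x in (S : set (borel_rV R n))) (enorm (T i x - T' i x) ^+ 2)%:E
  <= \int[rho]_(x in (S : set (borel_rV R n))) (bary_cost lam (with_id T x))%:E +
   \int[rho]_(x in (S : set (borel_rV R n))) (bary_cost lam (with_id T' x))%:E +
   (2^-1)%:E * \int[rho]_(x in (S : set (borel_rV R n)))
     (enorm (bary_map lam T x - bary_map lam T' x) ^+ 2)%:E)%E.
Proof.
have md : measurable_fun (S : set (borel_rV R n)) (fun x => (enorm (T i x - T' i x) ^+ 2)%:E).
  by apply/measurable_EFinP; apply: measurable_funX; exact: measurable_fun_enormB.
have mb : measurable_fun (S : set (borel_rV R n))
    (fun x => (enorm (bary_map lam T x - bary_map lam T' x) ^+ 2)%:E).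
  apply/measurable_EFinP; apply: measurable_funX; apply: measurable_fun_enormB.
    exact: (measurable_barycenter lam mwT).
  exact: (measurable_barycenter lam mwT').
have mcost (g : 'rV[R]_n -> 'I_N -> 'rV[R]_n) :
    (forall k, measurable_fun (S : set (borel_rV R n))
       ((fun x => g x k) : borel_rV R n -> borel_rV R n)) ->
    measurable_fun (S : set (borel_rV R n))
      (fun x : borel_rV R n => (bary_cost lam (g x))%:E).
  by move=> mg; apply/measurable_EFinP; exact: (measurable_bary_cost mg lam_gt0 lam1).
have mcU := mcost (fun x => U x) mU.
have mcU' := mcost (fun x => U' x) mU'.
have mcT := mcost (with_id T) mwT.
have mcT' := mcost (with_id T') mwT'.
have c0 (x : 'I_N -> 'rV[R]_n) : (0 <= (bary_cost lam x)%:E)%E.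
  by rewrite lee_fin bary_cost_ge0.
have s0 (r : R) : (0 <= (r ^+ 2)%:E)%E by rewrite lee_fin sqr_ge0.
have l0 : 0 <= lam i ^+ 2 / 2 by rewrite divr_ge0// sqr_ge0.
have h0 : 0 <= 2^-1 :> R by rewrite invr_ge0.
have int3 (f1 f2 f3 : borel_rV R n -> \bar R) (k : R) :
    measurable_fun (S : set (borel_rV R n)) f1 ->
    measurable_fun (S : set (borel_rV R n)) f2 ->
    measurable_fun (S : set (borel_rV R n)) f3 ->
    (forall x, 0 <= f1 x)%E -> (forall x, 0 <= f2 x)%E -> (forall x, 0 <= f3 x)%E ->
    0 <= k ->
    (\int[rho]_(x in (S : set (borel_rV R n))) f1 x +
     \int[rho]_(x in (S : set (borel_rV R n))) f2 x +
     k%:E * \int[rho]_(x in (S : set (borel_rV R n))) f3 x =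
     \int[rho]_(x in (S : set (borel_rV R n))) (f1 x + f2 x + k%:E * f3 x))%E.
  move=> mf1 mf2 mf3 f10 f20 f30 k0.
  rewrite -ge0_integralZl_EFin//.
  have -> : (\int[rho]_(x in (S : set (borel_rV R n))) f1 x +
     \int[rho]_(x in (S : set (borel_rV R n))) f2 x =
     \int[rho]_(x in (S : set (borel_rV R n))) (f1 x + f2 x))%E.
    by apply/esym; exact: ge0_integralD.
  apply/esym; apply: ge0_integralD => //.
  - by move=> x _; rewrite adde_ge0.
  - exact: emeasurable_funD.
  - by move=> x _; rewrite mule_ge0// lee_fin.
  - exact: measurable_funeM.
rewrite [leLHS](int3 _ _ _ _ mcU mcU' md (fun x => c0 (U x)) (fun x => c0 (U' x))
  (fun x => s0 _) l0).
rewrite [leRHS](int3 _ _ _ _ mcT mcT' mb (fun x => c0 (with_id T x))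
  (fun x => c0 (with_id T' x)) (fun x => s0 _) h0).
have kf0 (k : R) (g : \bar R) : 0 <= k -> (0 <= g)%E -> (0 <= k%:E * g)%E.
  by move=> k0 g0; rewrite mule_ge0// lee_fin.
apply: ge0_le_integral => //.
- by move=> x _; rewrite !adde_ge0// kf0.
- exact: (emeasurable_funD (emeasurable_funD mcU mcU') (measurable_funeM _ md)).
- exact: (emeasurable_funD (emeasurable_funD mcT mcT') (measurable_funeM _ mb)).
- move=> x Sx; rewrite -!EFinM -!EFinD lee_fin.
  have := bary_cost_swap lam_gt0 lam1 (with_id T x) (with_id T' x) i.
  by rewrite !with_idi mulrAC [2^-1 * _]mulrC.
Qed.

(** Integrate [bary_cost_swap] at [with_id T x] and [with_id T' x], and use
    [optimal_cost_le_update] for both problems; the costs of the exchanged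
    families are finite and cancel. *)
Lemma swap_stability (pi : probability (borel_rV R n * borel_rV R n)%type R) :
  coupling (mu i) (mu' i) pi ->
  ((lam i ^+ 2)%:E *
     \int[rho]_(x in (S : set (borel_rV R n))) (enorm (T i x - T' i x) ^+ 2)%:E
   <= \int[rho]_(x in (S : set (borel_rV R n)))
        (enorm (bary_map lam T x - bary_map lam T' x) ^+ 2)%:E
      + (4 * (lam i * D))%:E * \int[pi]_z (enorm (z.1 - z.2 : 'rV[R]_n))%:E)%E.
Proof.
move=> cpl; set w := (\int[pi]_z _)%E.
have w0 : (0 <= w)%E by apply: integral_ge0 => z _; rewrite lee_fin enorm_ge0.
have law1 B : measurable B -> pi (fst @^-1` B) = mu i B.
  move=> /cpl[<- _]; congr (pi _).
  by apply/seteqP; split => -[a b] //= [].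
have law2 B : measurable B -> pi (snd @^-1` B) = mu' i B.
  move=> /cpl[_ <-]; congr (pi _).
  by apply/seteqP; split => -[a b] //= [].
have [TT TT'] := (Tmu.1 i i0, Tmu'.1 i i0).
have [a a0 aE] := integral_dist_finite; have [b b0 bE] := integral_bary_finite.
have [wy|wfin] := eqVneq w +oo%E.
  by rewrite wy gt0_muley ?lte_fin ?mulr_gt0// bE addey// leey.
have [v wv] : exists v : R, w = v%:E.
  by exists (fine w); rewrite fineK// ge0_fin_numE// ltey.
have finite_cost (g : 'rV[R]_n -> 'I_N -> 'rV[R]_n) :
    (forall k, measurable_fun (S : set (borel_rV R n))
       ((fun x => g x k) : borel_rV R n -> borel_rV R n)) ->
    (forall k x, S x -> (S `|` Y) (g x k)) -> exists r : R,
    (\int[rho]_(x in (S : set (borel_rV R n))) (bary_cost lam (g x))%:E = r%:E)%E.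
  move=> mg gSY; have [||r _ rE] := @ge0_bounded_integralE
    (fun x => bary_cost lam (g x)) (D ^+ 2 / 2).
  - exact: (measurable_bary_cost mg lam_gt0 lam1).
  - move=> x Sx; rewrite (bary_cost_ge0 lam_gt0 lam1)/=.
    by apply: (bary_cost_le_diam i) => k; exact: gSY.
  - by exists r.
have USY k x : S x -> (S `|` Y) (U x k).
  move=> Sx; rewrite /update; case: eqP => _; last exact: TSY.
  by rewrite -with_idi; exact: TSY'.
have USY' k x : S x -> (S `|` Y) (U' x k).
  move=> Sx; rewrite /update; case: eqP => _; last exact: TSY'.
  by rewrite -with_idi; exact: TSY.
have [A AE] := finite_cost (fun x => U x) mU USY.
have [A' AE'] := finite_cost (fun x => U' x) mU' USY'.
have [I IE] := finite_cost (with_id T) mwT (fun k x => @TSY x k).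
have [I' IE'] := finite_cost (with_id T') mwT' (fun k x => @TSY' x k).
have H1 : I <= A + lam i * D * v.
  have := optimal_cost_le_update i0 Tmu Ymu TT' measurable_snd measurable_fst law2 law1.
  rewrite /mm_monge_cost IE AE [X in (_ * X)%E](_ : _ = w); last exact: eq_integral.
  by rewrite wv -EFinM -EFinD lee_fin.
have H2 : I' <= A' + lam i * D * v.
  have := optimal_cost_le_update i0 Tmu' Ymu' TT measurable_fst measurable_snd law1 law2.
  rewrite /mm_monge_cost IE' AE' [X in (_ * X)%E](_ : _ = w); last first.
    by apply: eq_integral => z _; rewrite enormBC.
  by rewrite wv -EFinM -EFinD lee_fin.
have H3 : A + A' + lam i ^+ 2 / 2 * a <= I + I' + 2^-1 * b.
  have := integral_bary_cost_swap.
  by rewrite AE AE' IE IE' aE bE -!EFinM -!EFinD lee_fin.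
rewrite aE bE wv -!EFinM -EFinD lee_fin.
rewrite mulrAC in H3; rewrite -(mulrA 4 (lam i * D) v).
set q := lam i ^+ 2 * a in H3 *; set kv := lam i * D * v in H1 H2 *.
by lra.
Qed.

(** Square roots of [swap_stability], after optimizing over the couplings. The
    bound [s] is a parameter so that one [s] serves all the indices [i]. *)
Lemma stability_coordinate (s : R) : 0 <= s ->
  ((lam i)%:E * wasserstein1 (mu i) (mu' i) <= s%:E)%E ->
  ((lam i)%:E * L2norm S rho (fun x => (T i x - T' i x)%R) <=
   L2norm S rho (fun x => (bary_map lam T x - bary_map lam T' x)%R)
   + (2 * Num.sqrt (D * s))%:E)%E.
Proof.
move=> s0 Ws; have [a a0 aE] := integral_dist_finite.
have [b b0 bE] := integral_bary_finite.
have sq (r : R) : 0 <= r -> (r%:E `^ 2^-1 = (Num.sqrt r)%:E)%E.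
  by move=> r0; rewrite poweR_EFin powR12_sqrt.
rewrite !L2normE aE bE !sq// -EFinM -EFinD lee_fin.
have l0 := lam_gt0 i.
have lD0 : 0 < 4 * (lam i * D) by rewrite !mulr_gt0.
have infW : (((lam i ^+ 2 * a - b) / (4 * (lam i * D)))%:E <=
    wasserstein1 (mu i) (mu' i))%E.
  apply: le_ereal_inf_tmp => _ [pi cpl <-]; have := swap_stability cpl.
  set w := (\int[pi]_z _)%E.
  have w0 : (0 <= w)%E by apply: integral_ge0 => z _; rewrite lee_fin enorm_ge0.
  have [wy|wfin] := eqVneq w +oo%E; first by rewrite wy leey.
  have [v ->] : exists v : R, w = v%:E.
    by exists (fine w); rewrite fineK// ge0_fin_numE// ltey.
  rewrite aE bE -!EFinM -EFinD !lee_fin => H.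
  by rewrite ler_pdivrMr// lerBlDl mulrC [X in _ + X]mulrC mulrC.
have key : lam i ^+ 2 * a <= b + 4 * (D * s).
  have : ((lam i)%:E * ((lam i ^+ 2 * a - b) / (4 * (lam i * D)))%:E <= s%:E)%E.
    by apply: le_trans Ws; rewrite lee_pmul2l ?lte_fin.
  rewrite -EFinM lee_fin.
  have -> : lam i * ((lam i ^+ 2 * a - b) / (4 * (lam i * D))) =
      (lam i ^+ 2 * a - b) / (4 * D).
    by field; rewrite !gt_eqF.
  by rewrite ler_pdivrMr ?mulr_gt0// lerBlDl; lra.
rewrite -(@ler_pXn2r _ 2)// ?nnegrE ?addr_ge0 ?mulr_ge0 ?sqrtr_ge0 ?(ltW l0)//.
have Ds0 : 0 <= D * s by rewrite mulr_ge0// ltW.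
rewrite exprMn sqr_sqrtr// sqrrD exprMn !sqr_sqrtr// (le_trans key)//.
have sb := sqrtr_ge0 b; have sD := sqrtr_ge0 (D * s).
by have := mulr_ge0 sb sD; lra.
Qed.

End two_problems.
End stability.

(** There is no first coordinate in dimension 0, where the theorem reduces to
    this remark. *)
Lemma L2norm_dim0 (R : realType) (S : set 'rV[R]_0)
    (rho : probability (borel_rV R 0) R) (F : 'rV[R]_0 -> 'rV[R]_0) :
  L2norm S rho F = 0%E.
Proof.
rewrite L2normE integral0_eq ?poweR0r ?invr_eq0// => x _.
by rewrite /enorm big_ord0 sqrtr0 expr0n.
Qed.

Theorem theorem1p2 (R : realType) (N : nat) (D : R) :
  (3 <= N)%N ->
  exists2 C : R, 0 < C &
  forall (n : nat) (lam : 'I_N -> R) (S Y : set 'rV[R]_n)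
         (rho : probability (borel_rV R n) R),
    (forall i, 0 < lam i) -> \sum_(i < N) lam i = 1 ->
    compact S -> compact Y -> ediam (S `|` Y) = D ->
    prob_ac_on S rho ->
  forall mu mu' : 'I_N -> probability (borel_rV R n) R,
    (forall i : 'I_N, (0 < i)%N -> prob_on Y (mu i)) ->
    (forall i : 'I_N, (0 < i)%N -> prob_on Y (mu' i)) ->
  forall T T' : 'I_N -> 'rV[R]_n -> 'rV[R]_n,
    mm_optimal_maps lam S Y rho mu T ->
    mm_optimal_maps lam S Y rho mu' T' ->
    (\sum_(i < N | (0 < i)%N)
       (lam i)%:E * L2norm S rho (fun x => (T i x - T' i x)%R)
     <= C%:E * ((\sum_(i < N | (0 < i)%N)
                   (lam i)%:E * wasserstein1 (mu i) (mu' i)) `^ 2^-1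
                + L2norm S rho
                    (fun x => (bary_map lam T x - bary_map lam T' x)%R)))%E.
Proof.
move=> N3; have N0 : (0 < N)%N by exact: leq_trans N3.
(* A positive bound of the diameter: D itself vanishes if S and Y are one point. *)
pose D' := `|D| + 1; have D'0 : 0 < D' by rewrite ltr_wpDl.
pose c := 1 + 2 * Num.sqrt D'.
have c1 : 1 <= c by rewrite lerDl mulr_ge0// sqrtr_ge0.
have c0 : 0 < c by rewrite (lt_le_trans _ c1).
exists (N%:R * c); first by rewrite mulr_gt0// ltr0n.
case=> [|n] lam S Y rho lam_gt0 lam1 cS cY diamSY rho_ac mu mu' Ymu Ymu' T T' Topt Topt'.
  rewrite big1 => [|i _]; last by rewrite L2norm_dim0 mule0.
  rewrite mule_ge0 ?adde_ge0 ?poweR_ge0 ?Lnorm_ge0// lee_fin.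
  by rewrite mulr_ge0// ltW.
set W := (\sum_(i < N | _) _ * wasserstein1 _ _)%E.
set B := L2norm S rho (fun x => (bary_map lam T x - bary_map lam T' x)%R).
have W_ge0 i : (0 <= (lam i)%:E * wasserstein1 (mu i) (mu' i))%E.
  rewrite mule_ge0// ?lee_fin ?(ltW (lam_gt0 i))//.
  apply: le_ereal_inf_tmp => _ [pi _ <-].
  by apply: integral_ge0 => z _; rewrite lee_fin enorm_ge0.
have W0 : (0 <= W)%E by apply: sume_ge0.
have B0 : (0 <= B)%E by exact: Lnorm_ge0.
have C0 : 0 < N%:R * c by rewrite mulr_gt0// ltr0n.
have RHS0 : (0 <= (N%:R * c)%:E * (W `^ 2^-1 + B))%E.
  by rewrite mule_ge0// ?lee_fin ?(ltW C0)// adde_ge0// poweR_ge0.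
have [W_infty|W_finite] := eqVneq W +oo%E.
  rewrite W_infty poweRyr ?invr_eq0// addye; last by rewrite -ltNye (lt_le_trans _ B0).
  by rewrite gt0_muley ?lte_fin// leey.
have [s sE] : exists s : R, W = s%:E.
  by exists (fine W); rewrite fineK// ge0_fin_numE// ltey.
have s0 : 0 <= s by rewrite -lee_fin -sE.
pose S1 : prob_on S rho := rho_ac.1.
have mf := @measurable_coord R n.+1 ord0.
pose f : {RV rho >-> R} := HB.pack (fun x : borel_rV R n.+1 => (x : 'rV[R]_n.+1) ord0 ord0)
  (isMeasurableFun.Build _ _ _ _ _ mf).
have f0 r : rho (f @^-1` [set r]) = 0%E by exact: ac_hyperplane0 rho_ac.
have diamD a b : (S `|` Y) a -> (S `|` Y) b -> enorm (a - b) <= D'.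
  move=> SYa SYb; rewrite (le_trans (enorm_le_ediam _ SYa SYb))//; first exact: compactU.
  by rewrite diamSY (le_trans (ler_norm D))// lerDl.
have mS := measurable_compact_rV cS; have mY := measurable_compact_rV cY.
have each (i : 'I_N) : (0 < i)%N -> ((lam i)%:E * L2norm S rho (fun x => (T i x - T' i x)%R) <=
    c%:E * (W `^ 2^-1 + B))%E.
  move=> i0.
  have Wi : ((lam i)%:E * wasserstein1 (mu i) (mu' i) <= s%:E)%E.
    by rewrite -sE /W (bigD1 i)//= leeDl//; apply: sume_ge0.
  have := stability_coordinate lam_gt0 lam1 D'0 diamD mS mY S1 f0 i0 Topt Topt'
    (Ymu i i0) (Ymu' i i0) s0 Wi.
  move=> /le_trans; apply; rewrite -/B sE poweR_EFin powR12_sqrt// ge0_muleDr//.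
  rewrite addeC leeD//.
    rewrite -EFinM lee_fin sqrtrM ?(ltW D'0)// mulrA ler_wpM2r ?sqrtr_ge0//.
    by rewrite lerDr.
  by rewrite -[leLHS]mul1e lee_wpmul2r// lee_fin.
apply: (@le_trans _ _ (\sum_(i < N | (0 < i)%N) (c%:E * (W `^ 2^-1 + B)))%E).
  exact: lee_sum.
apply: (@le_trans _ _ (\sum_(i < N) (c%:E * (W `^ 2^-1 + B)))%E).
  rewrite big_mkcond/=; apply: lee_sum => i _; case: ifP => // _.
  by rewrite mule_ge0// ?lee_fin ?(ltW c0)// adde_ge0// poweR_ge0.
by rewrite EFinM -muleA mule_natl sumr_const card_ord.
Qed.
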